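(* Let $A$ be an $\mathfrak S$-multi-Koszul algebra over a field $\Bbbk$ and let $R$ denote a space (bimodule) of relations for $A$. Let $P$ be a subspace of $T_{\Bbbk}(A^1)$ such that $R\subseteq R_P$. The $\Bbbk$-algebra $U(P)$ is a PBW-deformation of $A$ if and only if $\langle R\rangle=\langle R_P\rangle$, there exists a morphism of filtered linear spaces $\alpha:R\to T_{\Bbbk}(A^1)$ such that $\alpha(R)\subseteq P\subseteq\langle\alpha(R)\rangle$, and either $c(A)=-1$ or $\alpha(R)$ satisfies the Jacobi conditions $(\mathcal J_1)$–$(\mathcal J_N)$, where $N=\max\mathfrak S$.
   Context: Multi-Koszul algebras: let $V$ be a finite-dimensional $\Bbbk$-vector space, $I$ a homogeneous ideal of $T_{\Bbbk}(V)$, $A=T_{\Bbbk}(V)/I$ (with $A^1=V$), and $R$ a space of relations for $A$, i.e. a graded subspace with $I=R\oplus(VI+IV)$. Assume $R$ is finite-dimensional, $R=\bigoplus_{s\in\mathfrak S}R^s$ with $\mathfrak S$ a finite set of integers $s\ge2$ and $R^s\subseteq V^{\otimes s}$. $A$ is ($\mathfrak S$-)multi-Koszul if, for every $i\ge2$, as graded vector spaces, $$\operatorname{Tor}_i^A(\Bbbk,\Bbbk)\cong\bigoplus_{s\in\mathfrak S}\ \bigcap_{j=0}^{n_s(i)-s}V^{\otimes j}\otimes R^s\otimes V^{\otimes(n_s(i)-s-j)},\qquad n_s(2j)=sj,\ n_s(2j+1)=sj+1$$ (for $i=0,1$ one always has $\operatorname{Tor}_0=\Bbbk$, $\operatorname{Tor}_1=V$).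 Let $T=T_{\Bbbk}(A^1)$, $p^n:T\to T^n$ the projection, $T^{\le n}=\bigoplus_{m\le n}T^m$, $X^{\le n}=X\cap T^{\le n}$, $\langle X\rangle$ the two-sided ideal generated by $X$. For a subspace $P\subseteq T$: $R_P:=\bigoplus_np^n(P^{\le n})$; $U(P):=T/\langle P\rangle$, filtered by the images of $T^{\le n}$. $U(P)$ is a PBW-deformation of $A=T/\langle R\rangle$ if the graded algebra map $T/\langle R\rangle\to\operatorname{gr}U(P)$, $x+\langle R\rangle\mapsto(x+\langle P\rangle)+U(P)^{\le n-1}$ ($x\in T^n$), is an isomorphism. A morphism of filtered spaces $\alpha:R\to T$ is a linear map with $\alpha(R^n)\subseteq T^{\le n}$, by convention always satisfying $p^n\alpha(r)=r$ for $r\in R^n$. For a subspace $Q\subseteq T$, $(\mathcal J_n)$ is the condition $Q_{n+1}\cap T^{\le n}\subseteq Q_n$, where $Q_n:=\sum_{i+j+k=n}T^{\le i}Q^{\le j}T^{\le k}$. $c(A)=-1$ if $\operatorname{Tor}_3^A(\Bbbk,\Bbbk)=0$, otherwise $c(A)=\sup\{n-1\mid\operatorname{Tor}^A_{3,n}(\Bbbk,\Bbbk)\ne0\}$ ($n$ the internal degree). *)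

(* Defs.v *)
From HB Require Import structures.
From mathcomp Require Import all_boot all_order all_algebra.
From mathcomp Require Import finmap multinomials.monalg.
From mathcomp Require Import boolp classical_sets functions constructive_ereal.

Set Implicit Arguments.
Unset Strict Implicit.
Unset Printing Implicit Defensive.

Import Order.TTheory GRing.Theory Num.Theory.

Local Open Scope quotient_scope.
Local Open Scope classical_set_scope.
Local Open Scope ring_scope.

Section Subspaces.
Context {K : fieldType} {E : lmodType K}.
Implicit Types X W : set E.

Definition subspace W : Prop :=
  W 0 /\ forall (a : K) x y, W x -> W y -> W (a *: x + y).

Definition span X : set E := smallest subspace X.

Definition sum_of X Y : set E := [set z | exists x y, [/\ X x, Y y & z = x + y]].

Definition is_direct_sum W X Y : Prop :=
  W = sum_of X Y /\ X `&` Y = [set 0].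

Definition finite_dimensional W : Prop := exists s : seq E, W = span [set` s].

Lemma span_subspace X : subspace (span X).
Proof.
split=> [W [[W0 _] _] //|a x y Xx Xy W WX].
by have [[_ WL] _] := WX; apply: WL; [apply: Xx|apply: Xy].
Qed.

Lemma sub_span X : X `<=` span X.
Proof. exact: sub_gen_smallest. Qed.

Lemma span_sub X W : subspace W -> X `<=` W -> span X `<=` W.
Proof. exact: smallest_sub. Qed.

Lemma span_id W : subspace W -> span W = W.
Proof. exact: smallest_id. Qed.

Section SubspaceTheory.
Variables (W : set E) (sW : subspace W).

Lemma sub0 : W 0. Proof. by case: sW. Qed.

Lemma subD x y : W x -> W y -> W (x + y).
Proof. by move=> Wx Wy; rewrite -[x]scale1r; apply: sW.2. Qed.

Lemma subZ a x : W x -> W (a *: x).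
Proof. by move=> Wx; rewrite -[_ *: _]addr0; apply: sW.2 => //; apply: sub0. Qed.

Lemma subN x : W x -> W (- x).
Proof. by rewrite -scaleN1r; apply: subZ. Qed.

Lemma subB x y : W x -> W y -> W (x - y).
Proof. by move=> Wx Wy; apply: subD => //; apply: subN. Qed.
End SubspaceTheory.

End Subspaces.

(* [quotient X] is the quotient of E by the linear span of X. *)
Section Quotient.
Context {K : fieldType} {E : lmodType K}.
Variable X : set E.

Definition eqmod (x y : E) : bool := `[< span X (x - y) >].

Fact eqmod_refl : reflexive eqmod.
Proof. by move=> x; apply/asboolP; rewrite subrr; case: (span_subspace X). Qed.

Fact eqmod_sym : symmetric eqmod.
Proof.
move=> x y; apply/idP/idP => /asboolP h; apply/asboolP;
  by rewrite -opprB; apply: subN h; apply: span_subspace.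
Qed.

Fact eqmod_trans : transitive eqmod.
Proof.
move=> y x z /asboolP xy /asboolP yz; apply/asboolP.
have -> : x - z = (x - y) + (y - z) by rewrite addrA subrK.
by apply: subD xy yz; apply: span_subspace.
Qed.

Canonical eqmod_equiv := EquivRel eqmod eqmod_refl eqmod_sym eqmod_trans.
Definition quotient := {eq_quot eqmod}.
HB.instance Definition _ := Choice.on quotient.

Definition qproj (x : E) : quotient := \pi_quotient x.
Definition qrepr (u : quotient) : E := repr u.

Lemma qreprK u : qproj (qrepr u) = u.
Proof. exact: reprK. Qed.

Lemma qprojP x y : qproj x = qproj y <-> span X (x - y).
Proof.
split=> [/eqP|h]; first by rewrite /qproj eqmodE => /asboolP.
by apply/eqP; rewrite /qproj eqmodE; apply/asboolP.
Qed.

Lemma qprojK x : span X (qrepr (qproj x) - x).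
Proof. by apply/qprojP; rewrite qreprK. Qed.

Definition qadd (u v : quotient) := qproj (qrepr u + qrepr v).
Definition qopp (u : quotient) := qproj (- qrepr u).
Definition qscale (a : K) (u : quotient) := qproj (a *: qrepr u).

Let sX := span_subspace X.

Lemma qprojD x y : qproj (x + y) = qadd (qproj x) (qproj y).
Proof.
apply/qprojP; rewrite -opprB; apply: (subN sX); rewrite opprD addrACA.
by apply: (subD sX); apply: qprojK.
Qed.

Lemma qprojN x : qproj (- x) = qopp (qproj x).
Proof.
apply/qprojP; rewrite opprK addrC; exact: qprojK.
Qed.

Lemma qprojZ a x : qproj (a *: x) = qscale a (qproj x).
Proof.
apply/qprojP; rewrite -scalerBr -opprB scalerN.
by apply: (subN sX); apply: (subZ sX); apply: qprojK.
Qed.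

Lemma qproj_ind (Q : quotient -> Prop) : (forall x, Q (qproj x)) -> forall u, Q u.
Proof. by move=> h u; rewrite -(qreprK u). Qed.

Fact qaddA : associative qadd.
Proof.
by elim/qproj_ind => x; elim/qproj_ind => y; elim/qproj_ind => z;
  rewrite -!qprojD addrA.
Qed.

Fact qaddC : commutative qadd.
Proof.
by elim/qproj_ind => x; elim/qproj_ind => y; rewrite -!qprojD addrC.
Qed.

Fact qadd0 : left_id (qproj 0) qadd.
Proof. by elim/qproj_ind => x; rewrite -qprojD add0r. Qed.

Fact qaddN : left_inverse (qproj 0) qopp qadd.
Proof. by elim/qproj_ind => x; rewrite -qprojN -qprojD addNr. Qed.

HB.instance Definition _ :=
  GRing.isZmodule.Build quotient qaddA qaddC qadd0 qaddN.

Fact qscaleA a b u : qscale a (qscale b u) = qscale (a * b) u.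
Proof. by elim/qproj_ind: u => x; rewrite -!qprojZ scalerA. Qed.

Fact qscale1 : left_id 1 qscale.
Proof. by elim/qproj_ind => x; rewrite -qprojZ scale1r. Qed.

Fact qscaleDr : right_distributive qscale +%R.
Proof.
move=> a; elim/qproj_ind => x; elim/qproj_ind => y.
by rewrite -[_ + _]qprojD -!qprojZ -[RHS]qprojD scalerDr.
Qed.

Fact qscaleDl u : {morph qscale^~ u : a b / a + b}.
Proof.
move=> a b; elim/qproj_ind: u => x.
by rewrite -!qprojZ -[RHS]qprojD scalerDl.
Qed.

HB.instance Definition _ :=
  GRing.Zmodule_isLmodule.Build K quotient qscaleA qscale1 qscaleDr qscaleDl.

Fact qproj_is_linear : linear qproj.
Proof. by move=> a x y; rewrite [LHS]qprojD [qproj (a *: x)]qprojZ. Qed.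

HB.instance Definition _ :=
  GRing.isLinear.Build K E quotient *:%R qproj qproj_is_linear.

End Quotient.

Arguments qproj {K E} X x.
Arguments qrepr {K E} X u.

(* Two graded spaces are isomorphic when their components of the same degree
   are; the component of degree n is a subspace of an ambient space that may
   depend on n.  A linear map defined on a subspace extends to the ambient
   space, so [phi] may be taken total. *)
Definition graded_iso {K : fieldType} {E F : nat -> lmodType K}
    (X : forall n, set (E n)) (Y : forall n, set (F n)) : Prop :=
  forall n, exists phi : {linear E n -> F n}, set_bij (X n) (Y n) phi.

Section Ideals.
Context {K : fieldType} {B : algType K}.
Implicit Types J X Y Z : set B.

Definition two_sided_ideal J : Prop :=
  subspace J /\ forall x y z, J y -> J (x * y * z).

Definition ideal X : set B := smallest two_sided_ideal X.

Definition prod_of X Y : set B := span [set z | exists x y, [/\ X x, Y y & z = x * y]].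

Lemma ideal_two_sided X : two_sided_ideal (ideal X).
Proof.
split; [split|].
- by move=> J [[[J0 _] _] _].
- by move=> a x y Xx Xy J JX; have [[[_ JL] _] _] := JX;
    apply: JL; [apply: Xx|apply: Xy].
- by move=> x y z Xy J JX; have [[_ JM] _] := JX; apply: JM; apply: Xy.
Qed.

Lemma span_ideal X : span (ideal X) = ideal X.
Proof. by apply: span_id; case: (ideal_two_sided X). Qed.

Lemma idealMl X x y : ideal X y -> ideal X (x * y).
Proof. by move=> /((ideal_two_sided X).2 x y 1); rewrite mulr1. Qed.

Lemma idealMr X x y : ideal X x -> ideal X (x * y).
Proof. by move=> /((ideal_two_sided X).2 1 x y); rewrite mul1r. Qed.

End Ideals.

(* The algebra B / <X>.  It is the zero ring when 1 is in <X>, hence only a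
   [pzRingType]; [lalgType] and [algType] require 1 != 0. *)
Section QuotientAlgebra.
Context {K : fieldType} {B : algType K}.
Variable X : set B.

Definition quotient_alg := quotient (ideal X).
HB.instance Definition _ := GRing.Lmodule.on quotient_alg.

Definition aproj : B -> quotient_alg := qproj (ideal X).
HB.instance Definition _ := GRing.Linear.on aproj.

Let arepr : quotient_alg -> B := @qrepr _ _ (ideal X).

Lemma aprojP x y : aproj x = aproj y <-> ideal X (x - y).
Proof. by rewrite -[X in _ <-> X _]span_ideal; apply: qprojP. Qed.

Lemma aproj_ind (Q : quotient_alg -> Prop) : (forall x, Q (aproj x)) -> forall u, Q u.
Proof. exact: qproj_ind. Qed.

Definition amul (u v : quotient_alg) : quotient_alg := aproj (arepr u * arepr v).

Lemma aprojM x y : aproj (x * y) = amul (aproj x) (aproj y).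
Proof.
apply/aprojP; set x' := arepr _; set y' := arepr _.
have hx : ideal X (x - x') by apply/aprojP; rewrite [RHS]qreprK.
have hy : ideal X (y - y') by apply/aprojP; rewrite [RHS]qreprK.
have -> : x * y - x' * y' = (x - x') * y + x' * (y - y').
  by rewrite mulrBl mulrBr addrA subrK.
by apply: (subD (ideal_two_sided X).1); [apply: idealMr|apply: idealMl].
Qed.

Fact amulA : associative amul.
Proof.
by elim/aproj_ind => x; elim/aproj_ind => y; elim/aproj_ind => z;
  rewrite -!aprojM mulrA.
Qed.

Fact amul1 : left_id (aproj 1) amul.
Proof. by elim/aproj_ind => x; rewrite -aprojM mul1r. Qed.

Fact amulr1 : right_id (aproj 1) amul.
Proof. by elim/aproj_ind => x; rewrite -aprojM mulr1. Qed.

Fact amulDl : left_distributive amul +%R.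
Proof.
elim/aproj_ind => x; elim/aproj_ind => y; elim/aproj_ind => z.
by rewrite -linearD -!aprojM -linearD mulrDl.
Qed.

Fact amulDr : right_distributive amul +%R.
Proof.
elim/aproj_ind => x; elim/aproj_ind => y; elim/aproj_ind => z.
by rewrite -linearD -!aprojM -linearD mulrDr.
Qed.

HB.instance Definition _ := GRing.Zmodule_isPzRing.Build quotient_alg
  amulA amul1 amulr1 amulDl amulDr.

Fact aproj_is_monoid_morphism : monoid_morphism aproj.
Proof. by split; [|exact: aprojM]. Qed.

HB.instance Definition _ :=
  GRing.isMonoidMorphism.Build B quotient_alg aproj aproj_is_monoid_morphism.

Lemma ascaleAl (a : K) (u v : quotient_alg) : a *: (u * v) = (a *: u) * v.
Proof.
elim/aproj_ind: u => x; elim/aproj_ind: v => y.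
by rewrite -rmorphM -!linearZ -rmorphM scalerAl.
Qed.

Lemma ascaleAr (a : K) (u v : quotient_alg) : a *: (u * v) = u * (a *: v).
Proof.
elim/aproj_ind: u => x; elim/aproj_ind: v => y.
by rewrite -rmorphM -!linearZ -rmorphM scalerAr.
Qed.

End QuotientAlgebra.

(* Tor^A(k,k) for A = B / <X> with grading [G], A_0 = k and augmentation ideal
   A_+ the sum of the [G m] with m > 0: the homology of k (x)_A Bar(A), where
   Bar(A) = A (x) (A_+)^{(x) i} is the normalized bar resolution of k.  In
   homological degree i this complex is (A_+)^{(x) i}, with differential
     [a_1|...|a_i] |-> \sum_(1 <= j < i) +-[a_1|...|a_j a_(j+1)|...|a_i].
   The tensor power A^{(x) i} is the free vector space [bar i] on i-tuples of
   elements of A modulo the span of the relations [multilin i]; chains,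
   cycles and boundaries are represented in [bar i]. *)
Section Tor.
Context {K : fieldType} {B : algType K}.
Variables (X : set B) (G : nat -> set (quotient_alg X)).

Local Notation A := (quotient_alg X).

Definition bar (i : nat) := {malg K[{ffun 'I_i -> A}]}.

Definition set_coord i (t : {ffun 'I_i -> A}) (j : 'I_i) (a : A) : {ffun 'I_i -> A} :=
  [ffun k => if k == j then a else t k].

Definition multilin i : set (bar i) :=
  [set z | exists (t : {ffun 'I_i -> A}) (j : 'I_i) (c : K) (a b : A),
     z = << set_coord t j (c *: a + b) >>
         - (c *: << set_coord t j a >> + << set_coord t j b >>)].

(* [a_0|...|a_i] |-> [a_0|...|a_j a_(j+1)|...|a_i] *)
Definition bar_face i (j : 'I_i) (t : {ffun 'I_i.+1 -> A}) : {ffun 'I_i -> A} :=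
  [ffun k : 'I_i =>
     let l := t (widen_ord (leqnSn i) k) in
     let r := t (lift ord0 k) in
     if (k < j)%N then l else if k == j then l * r else r].

Definition bar_diff i : bar i -> bar i.-1 :=
  match i with
  | 0 => fun _ => 0
  | i'.+1 => fun z =>
      \sum_(t <- msupp z) \sum_(j < i') (z@_t * (-1) ^+ j) *: << bar_face j t >>
  end.

(* Represents the component of (A_+)^{(x) i} of internal degree n. *)
Definition bar_chain i n : set (bar i) :=
  span [set z | exists (m : 'I_i -> nat) (t : {ffun 'I_i -> A}),
    [/\ forall k, (0 < m k)%N /\ G (m k) (t k),
        (\sum_k m k)%N = n & z = << t >>]].

Definition bar_cycle i n : set (bar i) :=
  [set z | bar_chain n z /\ span (multilin (i:=i.-1)) (bar_diff z)].

Definition bar_boundary i n : set (bar i) :=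
  [set bar_diff (i:=i.+1) z | z in bar_chain (i:=i.+1) n].

Definition bar_quotient (i n : nat) := quotient (@multilin i `|` @bar_boundary i n).
HB.instance Definition _ i n := GRing.Lmodule.on (bar_quotient i n).

(* Tor_{i,n}, as the space of classes of cycles. *)
Definition Tor (i n : nat) : set (bar_quotient i n) := qproj _ @` @bar_cycle i n.

Local Arguments Tor i n : clear implicits.

Definition Tor3_eq0 : Prop := forall n, Tor 3 n = [set 0].

(* The supremum is taken in {-oo} U Z U {+oo}, where it always exists. *)
Definition c_inv : \bar int :=
  if `[< Tor3_eq0 >] then (-1)%:E
  else supremum -oo%E [set (n%:Z - 1)%:E | n in [set n | Tor 3 n <> [set 0]]].

End Tor.

Arguments bar_quotient {K B X} G i n.
Arguments Tor {K B X} G i n.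

(* T(V) is realised as the free algebra on the coordinate basis of V: words in
   the basis form a basis of it.  [tensor_alg_universal] below is its universal
   property with respect to [tincl : V -> T(V)]. *)
Section TensorAlgebra.
Context {K : fieldType}.
Variable V : vectType K.

Definition word := {fmonom 'I_(\dim {:V})}.

Definition tensor_alg := {malg K[word]}.
HB.instance Definition _ := GRing.Lalgebra.on tensor_alg.

Fact tensor_scaleAr (a : K) (x y : tensor_alg) : a *: (x * y) = x * (a *: y).
Proof.
have mulC z : z * a%:MP = a *: z.
  rewrite (monalgE z) mulr_suml scaler_sumr; apply: eq_bigr => w _.
  rewrite malgM_def fgmulUU mulm1; apply/malgP => u.
  by rewrite mcoeffZ !mcoeffU mulrC mulrnAr.
by rewrite -[a *: y]mul_malgC mulrA mulC scalerAl.
Qed.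

HB.instance Definition _ :=
  GRing.Lalgebra_isAlgebra.Build K tensor_alg tensor_scaleAr.

Definition tincl (v : V) : tensor_alg :=
  \sum_i coord (vbasis {:V}) i v *: << fmu i >>.

Section Lift.
Variables (B : algType K) (f : {linear V -> B}).

Definition word_val (w : word) : B := \prod_(i <- (w : seq _)) f (vbasis {:V})`_i.

Fact word_val_mmorphism : mmorphism word_val.
Proof.
split=> [u v|]; rewrite /word_val; first by rewrite fmM big_cat.
by rewrite fm1 big_nil.
Qed.

HB.instance Definition _ :=
  isMultiplicative.Build word B word_val word_val_mmorphism.

Definition tlift (x : tensor_alg) : B := mmap (in_alg B) word_val x.

Fact tlift_is_monoid_morphism : monoid_morphism tlift.
Proof.
have [M1 M2] : multiplicative (mmap (in_alg B) word_val).
  apply: commr_mmap_is_multiplicative => g m m'.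
  by rewrite /GRing.comm /= mulr_algl mulr_algr.
by split; [exact: M2|exact: M1].
Qed.

Fact tlift_is_linear : linear tlift.
Proof.
move=> a x y; rewrite /tlift raddfD /=; congr (_ + _).
rewrite -mul_malgC -/(tlift (_ * _)) tlift_is_monoid_morphism.2.
by rewrite [X in X * _]mmapU /= (word_val_mmorphism.2) mulr1 mulr_algl.
Qed.

HB.instance Definition _ :=
  GRing.isLinear.Build K tensor_alg B *:%R tlift tlift_is_linear.
HB.instance Definition _ :=
  GRing.isMonoidMorphism.Build tensor_alg B tlift tlift_is_monoid_morphism.

End Lift.

Lemma tensor_alg_universal (B : algType K) (f : {linear V -> B}) :
  exists2 F : {lrmorphism tensor_alg -> B}, F \o tincl =1 f
    & forall G : {lrmorphism tensor_alg -> B}, G \o tincl =1 f -> G =1 F.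
Proof.
have tinclE (i : 'I_(\dim {:V})) : tincl (vbasis {:V})`_i = << fmu i >>.
  rewrite /tincl (bigD1 i) //= big1 => [|j ji].
    rewrite (coord_free i i (basis_free (vbasisP _))) eqxx scale1r addr0 //.
  by rewrite (coord_free i j (basis_free (vbasisP _))) eq_sym (negPf ji) scale0r.
exists (tlift f : {lrmorphism tensor_alg -> B}) => [v|G Gf x] /=.
  rewrite [in RHS](coord_vbasis (memvf v)) !linear_sum; apply: eq_bigr => i _.
  rewrite !linearZ /=; congr (_ *: _).
  by rewrite /tlift mmapU /= scale1r mul1r /word_val fmU big_seq1.
have GU (w : word) : G << w >> = word_val f w.
  case: w => w; elim: w => [|i w IH].
    by rewrite /word_val big_nil -[RHS](rmorph1 G); congr (G _); rewrite -fmoneE.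
  have -> : << FMonom (i :: w) >> = << fmu i >> * << FMonom w >> :> tensor_alg.
    by rewrite malgM_def fgmulUU mulr1; congr << _ >>; rewrite /mmul /= fmmulE fmuE.
  by rewrite rmorphM [X in _ * X]IH -tinclE /word_val big_cons; congr (_ * _); exact: Gf.
rewrite {1}(monalgE x) raddf_sum /tlift mmapE; apply: eq_bigr => w _.
rewrite -GU /= mulr_algl -linearZ; congr (G _); apply/malgP => u.
by rewrite mcoeffZ !mcoeffU mulrnAr mulr1.
Qed.

End TensorAlgebra.

Section MultiKoszul.
Context {K : fieldType} {V : vectType K}.

Local Notation T := (tensor_alg V).
Local Notation word := (word V).

Implicit Types (x : T) (I X P Q R : set T) (S : {fset nat}).

(* The homogeneous component of degree n of T, i.e. the span of the words of
   length n. *)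
Definition tdeg (n : nat) : set T :=
  [set x | forall w : word, w \in msupp x -> fdeg w = n].

Definition tdeg_le (n : nat) : set T :=
  [set x | forall w : word, w \in msupp x -> (fdeg w <= n)%N].

(* The projection p^n of T onto [tdeg n]. *)
Definition tproj (n : nat) (x : T) : T :=
  \sum_(w <- msupp x | fdeg w == n) << x@_w *g w >>.

Definition homogeneous X : Prop := forall n x, X x -> X (tproj n x).

Definition upto X (n : nat) : set T := X `&` tdeg_le n.

(* R is a space of relations, with degrees in S, of the algebra T / I. *)
Record space_of_relations I R S : Prop := {
  rel_ideal : two_sided_ideal I;
  rel_ideal_homogeneous : homogeneous I;
  rel_degree1 : forall v : V, I (tincl v) -> v = 0;
  rel_subspace : subspace R;
  rel_finite_dimensional : finite_dimensional R;
  rel_direct_sum :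
    is_direct_sum I R (sum_of (prod_of (range (@tincl K V)) I)
                              (prod_of I (range (@tincl K V))));
  rel_degree_ge2 : forall s, s \in S -> (2 <= s)%N;
  rel_degrees : R = span (\bigcup_(s in [set` S]) (R `&` tdeg s))
}.

(* A^n, for A = T / <X>. *)
Definition alg_deg X (n : nat) : set (quotient_alg X) := aproj X @` tdeg n.
Arguments alg_deg : clear implicits.

Definition tor_deg (s i : nat) : nat :=
  if odd i then (s * i./2).+1 else (s * i./2)%N.

Definition koszul_space R (s m : nat) : set T :=
  \bigcap_(j in [set j | (j <= m - s)%N])
    prod_of (prod_of (tdeg j) (R `&` tdeg s)) (tdeg (m - s - j)).

(* The component of degree n of the direct sum, over s in S, of the
   [koszul_space R s (tor_deg s i)]; the s-th summand lives in degree
   [tor_deg s i]. *)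
Definition koszul_sum R S (i n : nat) : set {ffun S -> T} :=
  [set g | forall s : S,
     if tor_deg (val s) i == n then koszul_space R (val s) n (g s) else g s = 0].
Arguments koszul_sum : clear implicits.

Definition multi_koszul I R S : Prop :=
  forall i, (2 <= i)%N ->
    graded_iso (E := bar_quotient (alg_deg I) i) (F := fun=> {ffun S -> T})
      (Tor (alg_deg I) i) (koszul_sum R S i).

Definition top_parts P : set T :=
  span (\bigcup_n (tproj n @` upto P n)).

(* The filtration of U(P) = T / <P>, and the ambient space U(P) / U(P)^{<= n-1}
   of the component of degree n of gr U(P). *)
Definition ufilt P (n : nat) : set (quotient_alg P) := aproj P @` tdeg_le n.
Arguments ufilt : clear implicits.

Definition ufilt_pred P (n : nat) : set (quotient_alg P) :=
  if n is m.+1 then ufilt P m else [set 0].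
Arguments ufilt_pred : clear implicits.

Definition gr P (n : nat) : set (quotient (ufilt_pred P n)) :=
  qproj _ @` ufilt P n.
Arguments gr : clear implicits.

(* For every n the component (T / <R>)^n -> gr^n U(P),
   x + <R> |-> (x + <P>) + U(P)^{<= n-1}, of the canonical map is well defined
   and bijective.  These components multiply as the classes of their
   representatives x, so together they always form a morphism of algebras. *)
Definition pbw_deformation R P : Prop :=
  forall n, exists phi : {linear quotient_alg R -> quotient (ufilt_pred P n)},
    (forall x, tdeg n x -> phi (aproj R x) = qproj _ (aproj P x)) /\
    set_bij (alg_deg R n) (gr P n) phi.

(* Morphisms of filtered spaces R -> T, as restrictions of maps T -> T. *)
Definition filtered_morphism R (alpha : T -> T) : Prop :=
  (forall (a : K) x y, R x -> R y ->
     alpha (a *: x + y) = a *: alpha x + alpha y) /\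
  (forall n r, R r -> tdeg n r -> tdeg_le n (alpha r) /\ tproj n (alpha r) = r).

Definition jacobi_space Q (n : nat) : set T :=
  span (\bigcup_(t in [set t : nat * nat * nat | (t.1.1 + t.1.2 + t.2)%N = n])
    prod_of (prod_of (tdeg_le t.1.1) (upto Q t.1.2)) (tdeg_le t.2)).

Definition jacobi Q (n : nat) : Prop :=
  jacobi_space Q n.+1 `&` tdeg_le n `<=` jacobi_space Q n.

End MultiKoszul.

Arguments alg_deg {K V} X n.
Arguments koszul_sum {K V} R S i n.
Arguments ufilt {K V} P n.
Arguments ufilt_pred {K V} P n.
Arguments gr {K V} P n.

(* Main.v *)
From Pilot Require Import Defs.
From HB Require Import structures.
From mathcomp Require Import all_boot all_order all_algebra.
From mathcomp Require Import finmap multinomials.monalg.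
From mathcomp Require Import zify.
From mathcomp Require Import boolp classical_sets functions constructive_ereal.

(* Write Q = alpha(R).  The algebra U(P) is a PBW-deformation when the components
   of degree n of the elements of <P> of degree at most n lie in <R>; when
   <P> = <Q> this follows from the Jacobi conditions in all degrees.  Condition
   (J_n) says that every syzygy sum u (x) r (x) w of R of degree n + 1 is sent
   into Q_n by u (x) r (x) w |-> u alpha(r) w.  This holds for left and right
   multiples of syzygies of degree n by (J_(n-1)), and for the syzygies
   r t [r'] - [r] t r' because r - alpha(r) has lower degree.  Other syzygies of
   degree n + 1 are measured by Tor_(3,n+1), the component of degree n + 1 of
   ((T_+ I) /\ (I T_+)) / (I^2 + T_+ I T_+), which for a multi-Koszul algebra
   vanishes unless n is in S. *)

(* Imported again so that [span] is not the one of [vector]. *)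
Import Pilot.Defs.

Set Implicit Arguments.
Unset Strict Implicit.
Unset Printing Implicit Defensive.

Import Order.TTheory GRing.Theory Num.Theory.

Local Open Scope classical_set_scope.
Local Open Scope ring_scope.

(** * Linear algebra *)

(** Only one half of the description of Tor_3 is needed: if Tor_(3,m) is zero, an element of degree
    m of (T_+ I) /\ (I T_+) lies in I^2 + T_+ I T_+. The obstacle is that Tor is given by bar chains
    over A, whereas the ideals live in T. A linear section of T -> A bridges the two: it turns a bar
    chain of length three into an element of T, and a boundary into an element of I^2 + T_+ I T_+.

    The bound N comes from n_s(3) = s + 1: past degree N + 1 no new syzygy appears and the induction
    on n runs by itself. It starts in degree 1, where R vanishes. The tensor product T (x) R (x) T
    is never built; a pair of values in T x T carries all that is used of one of its elements.

    For a given PBW-deformation, alpha is chosen linearly, degree by degree, among the elements of P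
    with a prescribed top part. Comparing top parts then shows that every element of <P> of degree
    at most n lies in Q_n; this yields both the inclusion of P in <Q> and all Jacobi conditions. *)

Section SubspaceTheory.
Context {K : fieldType} {E : lmodType K}.
Implicit Types (W X : set E).

Lemma sub_sum W (sW : subspace W) (J : Type) (r : seq J) (F : J -> E) :
  (forall j, W (F j)) -> W (\sum_(j <- r) F j).
Proof.
move=> WF; elim: r => [|j r IH]; first by rewrite big_nil; apply: sub0.
by rewrite big_cons; apply: subD.
Qed.

Lemma span_mono X Y : X `<=` Y -> span X `<=` span Y.
Proof.
by move=> XY; apply: span_sub; [exact: span_subspace|move=> x /XY; exact: sub_span].
Qed.

Lemma subspaceI W X : subspace W -> subspace X -> subspace (W `&` X).
Proof.
move=> [W0 WL] [X0 XL]; split=> // a x y [? ?] [? ?]; split;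
  [exact: WL|exact: XL].
Qed.

Lemma linear_at0 (F : lmodType K) (f : E -> F) : linear f -> f 0 = 0.
Proof. by move=> fl; have := fl (-1) 0 0; rewrite scaler0 addr0 scaleN1r addNr. Qed.

Lemma subspace_preimage (F : lmodType K) (f : E -> F) (W : set F) :
  linear f -> subspace W -> subspace [set x | W (f x)].
Proof.
move=> fl sW; split=> [|a x y /= Wx Wy].
  by rewrite /= linear_at0 //; apply: sub0.
by rewrite fl; apply: sW.2.
Qed.

Lemma subspace_eq (F : lmodType K) (f g : E -> F) :
  linear f -> linear g -> subspace [set x | f x = g x].
Proof.
move=> fl gl; split=> [|a x y /= fx fy]; last by rewrite fl gl fx fy.
by rewrite /= !linear_at0.
Qed.

Lemma linear_bigsum (F : lmodType K) (f : E -> F) (J : Type) (r : seq J) (g : J -> E) :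
  linear f -> f (\sum_(j <- r) g j) = \sum_(j <- r) f (g j).
Proof.
move=> fl; elim: r => [|j r IH]; first by rewrite !big_nil linear_at0.
by rewrite !big_cons -[in LHS](scale1r (g j)) fl scale1r IH.
Qed.

(** [N] is the projection along [W] onto a complement containing [C0]; the complement comes from
    Zorn's lemma, since [E] may have infinite dimension. *)
Lemma exists_projection W (C0 : set E) :
  subspace W -> subspace C0 -> C0 `&` W `<=` [set 0] ->
  exists N : E -> E,
    [/\ linear N, forall x, W (x - N x), forall x, W x -> N x = 0
      & forall x, C0 x -> N x = x].
Proof.
move=> sW sC0 C0W.
(* The union of the empty chain is empty, so [Q] has to accept the empty set: it does not ask for
   [0], and asks for [C0] only when [C] is nonempty. *)
pose Q (C : set E) := [/\ forall (a : K) x y, C x -> C y -> C (a *: x + y),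
  C `&` W `<=` [set 0] & C !=set0 -> C0 `<=` C].
have [F FQ Ftot|A [[AL AW AC0] Amax]] := @Zorn_bigcup E Q.
  split.
  - move=> a x y [X FX Xx] [Y FY Yy].
    have [XY|YX] := Ftot _ _ FX FY.
    + by exists Y => //; have [YL _ _] := FQ _ FY; apply: YL => //; apply: XY.
    + by exists X => //; have [XL _ _] := FQ _ FX; apply: XL => //; apply: YX.
  - by move=> x [[X FX Xx] Wx]; have [_ XW _] := FQ _ FX; apply: XW.
  - move=> [x [X FX Xx]] y C0y; exists X => //.
    by have [_ _ XC] := FQ _ FX; apply: XC => //; exists x.
have A0 : A !=set0.
  apply/set0P/eqP => A0; apply: (Amax C0).
    split; first by rewrite A0.
    by move=> /(_ 0 (sub0 sC0)); rewrite A0.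
  by split; [exact: sC0.2|exact: C0W|move=> _ x].
have {}AC0 := AC0 A0.
have sA : subspace A by split; [exact/AC0/(sub0 sC0)|exact: AL].
have dec x : exists c, A c /\ W (x - c).
  apply: contrapT => nx.
  pose B := [set z | exists k c, A c /\ z = k *: x + c].
  have AB : A `<=` B by move=> c Ac; exists 0, c; rewrite scale0r add0r.
  apply: (Amax B).
    split=> // /(_ x) BA; apply: nx; exists x; split; last first.
      by rewrite subrr; apply: sub0.
    by apply: BA; exists 1, 0; rewrite scale1r addr0; split=> //; apply: sub0.
  split=> [a _ _ [k [c [Ac ->]]] [l [d [Ad ->]]]||_]; last exact: subset_trans AB.
    exists (a * k + l), (a *: c + d); split; first exact: AL.
    by rewrite scalerDr scalerA scalerDl addrACA.
  move=> _ [[k [c [Ac ->]]] Wz].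
  have [k0|k0] := eqVneq k 0.
    by move: Wz; rewrite k0 scale0r add0r => Wc; apply: AW.
  case: nx; exists (- k^-1 *: c); split; first exact: subZ.
  have -> : x - - k^-1 *: c = k^-1 *: (k *: x + c).
    by rewrite scalerDr scalerA mulVf // scale1r scaleNr opprK.
  exact: subZ.
have uniq c d : A c -> A d -> W (c - d) -> c = d.
  move=> Ac Ad Wcd; apply/eqP; rewrite -subr_eq0; apply/eqP.
  by apply: AW; split=> //; apply: subB.
have [N NP] := choice dec.
exists N; split.
- move=> a x y; have [Ax Wx] := NP x; have [Ay Wy] := NP y.
  have [Az Wz] := NP (a *: x + y); apply: uniq => //; first exact: AL.
  have -> : N (a *: x + y) - (a *: N x + N y) =
      (a *: (x - N x) + (y - N y)) - (a *: x + y - N (a *: x + y)).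
    by rewrite scalerBr addrACA -opprD opprB [RHS]addrC addrA subrK.
  by apply: subB => //; apply: sW.2.
- by move=> x; have [] := NP x.
- move=> x Wx; have [Ax Wx'] := NP x; apply: uniq => //; first exact: sub0.
  by rewrite subr0; have := subB sW Wx Wx'; rewrite opprB addrC subrK.
- move=> x /AC0 Ax; have [ANx Wx] := NP x; apply: uniq => //.
  by rewrite -opprB; apply: subN.
Qed.

End SubspaceTheory.

(** Two values of the linear relation [G] at one point differ by an element of [G 0], so projecting
    an arbitrary choice function along [G 0] makes it linear. *)
Lemma linear_selection (K : fieldType) (E F : lmodType K) (D : set E) (G : E -> set F) :
  subspace D -> (forall x, D x -> G x !=set0) ->
  (forall a x y u v, G x u -> G y v -> G (a *: x + y) (a *: u + v)) ->
  exists f : E -> F, (forall x, D x -> G x (f x)) /\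
    forall a x y, D x -> D y -> f (a *: x + y) = a *: f x + f y.
Proof.
move=> sD Dex GL.
have G00 : G 0 0.
  have [u Gu] := Dex 0 (sub0 sD).
  by have := GL (-1) _ _ _ _ Gu Gu; rewrite !scaleN1r !addNr.
have sG : subspace (G 0).
  by split=> // a x y Gx Gy; have := GL a _ _ _ _ Gx Gy; rewrite scaler0 addr0.
have s0 : subspace [set 0 : F].
  by split=> // a x y -> ->; rewrite scaler0 addr0.
have [|N [Nlin NG N0 _]] := exists_projection sG s0; first by move=> x [].
have [g gP] : {g : E -> F & forall x, D x -> G x (g x)}.
  apply: (@choice _ _ (fun x u => D x -> G x u)) => x.
  by have [/Dex [u Gu]|nDx] := pselect (D x); [exists u|exists 0].
exists (N \o g); split=> [x /gP Gx|a x y Dx Dy] /=.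
  have := GL (-1) _ _ _ _ (NG (g x)) Gx.
  by rewrite scaler0 add0r scaleN1r opprB subrK.
have Gz := gP _ (sD.2 a _ _ Dx Dy).
rewrite -Nlin; apply/eqP; rewrite -subr_eq0 -[_ - _]addrC -scaleN1r -Nlin; apply/eqP.
apply: N0; have := GL (-1) _ _ _ _ (GL a _ _ _ _ (gP _ Dx) (gP _ Dy)) Gz.
by rewrite scaleN1r addNr.
Qed.


Section LinearExtension.
Context {K : fieldType} {J : choiceType}.
Local Notation M := {malg K[J]}.

Lemma malg_expand (x : M) : x = \sum_(k <- msupp x) x@_k *: << k >>.
Proof.
rewrite {1}(monalgE x); apply: eq_bigr => k _; apply/malgP => l.
by rewrite mcoeffZ !mcoeffU mulrnAr mulr1.
Qed.

Lemma malg_ind (W : set M) (x : M) : subspace W ->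
  (forall k, k \in msupp x -> W << k >>) -> W x.
Proof.
move=> sW WU; rewrite (malg_expand x) big_seq.
elim/big_ind : _ => [|y z|k kx]; [exact: sub0|exact: subD|].
by apply: subZ => //; apply: WU.
Qed.

Context {E : lmodType K} (f : J -> E).

Definition lext : M -> E := locked (fun x => \sum_(k <- msupp x) x@_k *: f k).

Lemma lextE x : lext x = \sum_(k <- msupp x) x@_k *: f k.
Proof. by rewrite /lext -lock. Qed.

Lemma lextEw (D : {fset J}) x : {subset msupp x <= D} ->
  lext x = \sum_(k <- D) x@_k *: f k.
Proof.
move=> xD; rewrite lextE (@big_fset_incl _ _ _ _ (msupp x) D) //.
  exact/fsubsetP.
by move=> k _ /mcoeff_outdom ->; rewrite scale0r.
Qed.

Lemma lext_is_linear : linear lext.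
Proof.
move=> a x y; pose D := (msupp (a *: x + y) `|` (msupp x `|` msupp y))%fset.
rewrite !(@lextEw D).
- rewrite scaler_sumr -big_split; apply: eq_bigr => k _ /=.
  by rewrite mcoeffD mcoeffZ scalerA scalerDl.
- by move=> k ky; rewrite /D !inE ky !orbT.
- by move=> k kx; rewrite /D !inE kx !orbT.
- by move=> k kx; rewrite /D !inE kx.
Qed.

HB.instance Definition _ := GRing.isLinear.Build K M E *:%R lext lext_is_linear.

Lemma lextU k : lext << k >> = f k.
Proof.
rewrite (@lextEw [fset k]%fset) => [|l /(fsubsetP msuppU_le) //].
by rewrite big_seq_fset1 mcoeffUU scale1r.
Qed.

End LinearExtension.

(** * Words in the tensor algebra *)

Section TensorAlgebra.
Context {K : fieldType} {V : vectType K}.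

Local Notation T := (tensor_alg V).
Local Notation d := (\dim {:V}).
Implicit Types (x y z : T) (s t u w : seq 'I_d).

(* The library's free algebra and the projections [tproj] unfold into finitely
   supported maps and iterated sums, on which conversion may diverge; hence the
   locked copies. *)
Definition mon : seq 'I_d -> T := locked (fun s => << FMonom s >>).
Definition wcoef : seq 'I_d -> T -> K := locked (fun s x => x@_(FMonom s)).
Definition hpart : nat -> T -> T := locked (@tproj K V).
Definition letter (i : 'I_d) : T := mon [:: i].

Lemma monE s : mon s = << FMonom s >>. Proof. by rewrite /mon -lock. Qed.
Lemma wcoefE s x : wcoef s x = x@_(FMonom s). Proof. by rewrite /wcoef -lock. Qed.
Lemma tprojE n x : tproj n x = hpart n x. Proof. by rewrite /hpart -lock. Qed.

Lemma wcoef_is_linear s a x y : wcoef s (a *: x + y) = a * wcoef s x + wcoef s y.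
Proof. by rewrite !wcoefE mcoeffD mcoeffZ. Qed.
HB.instance Definition _ s :=
  GRing.isLinear.Build K T K *%R (wcoef s) (wcoef_is_linear s).

Lemma wcoef0 s : wcoef s 0 = 0. Proof. exact: linear0. Qed.

Lemma wcoefB s x y : wcoef s (x - y) = wcoef s x - wcoef s y.
Proof. exact: linearB. Qed.

Lemma wcoef_mon s t : wcoef s (mon t) = (t == s)%:R.
Proof. by rewrite wcoefE monE mcoeffU1 fmP. Qed.

Lemma wcoefP x y : (forall s, wcoef s x = wcoef s y) -> x = y.
Proof. by move=> xy; apply/malgP => -[s]; rewrite -!wcoefE; apply: xy. Qed.

Lemma mon_nil : mon [::] = 1.
Proof. by rewrite monE -fmoneE. Qed.

Lemma monM s t : mon s * mon t = mon (s ++ t).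
Proof.
rewrite !monE malgM_def fgmulUU mulr1; congr << _ >>.
by rewrite /mmul /= fmmulE.
Qed.

Lemma mon_cons i s : mon (i :: s) = letter i * mon s.
Proof. by rewrite monM. Qed.

Lemma mon_rcons s i : mon (rcons s i) = mon s * letter i.
Proof. by rewrite monM cats1. Qed.

Lemma mon_ind (W : set T) x : subspace W ->
  (forall s, wcoef s x != 0 -> W (mon s)) -> W x.
Proof.
move=> sW WU; apply: malg_ind => // -[s] xs; rewrite -monE; apply: WU.
by rewrite wcoefE mcoeff_neq0.
Qed.

Lemma linear_mon_eq (E : lmodType K) (f g : T -> E) x : linear f -> linear g ->
  (forall s, wcoef s x != 0 -> f (mon s) = g (mon s)) -> f x = g x.
Proof. by move=> fl gl fg; apply: (mon_ind (subspace_eq fl gl)). Qed.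

Lemma subspace_mull a (W : set T) : subspace W -> subspace [set x | W (a * x)].
Proof.
by apply: subspace_preimage => c x y; rewrite mulrDr scalerAr.
Qed.

Lemma subspace_mulr a (W : set T) : subspace W -> subspace [set x | W (x * a)].
Proof.
by apply: subspace_preimage => c x y; rewrite mulrDl scalerAl.
Qed.

Lemma tdegP n x : tdeg n x <-> forall s, size s != n -> wcoef s x = 0.
Proof.
split=> [xn s sn|xn [s]].
  by apply/eqP; rewrite wcoefE mcoeff_eq0; apply: contra sn => /xn /eqP.
by rewrite -mcoeff_neq0 -wcoefE; apply: contra_neq_eq => /xn.
Qed.

Lemma tdeg_leP n x : tdeg_le n x <-> forall s, (n < size s)%N -> wcoef s x = 0.
Proof.
split=> [xn s sn|xn [s]].
  apply/eqP; rewrite wcoefE mcoeff_eq0; apply: contraL sn => /xn.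
  by rewrite -leqNgt.
rewrite -mcoeff_neq0 -wcoefE leqNgt; apply: contra_neqN; exact: xn.
Qed.

Lemma tdeg_subspace n : subspace (@tdeg K V n).
Proof.
split=> [|a x y /tdegP xn /tdegP yn]; apply/tdegP => s sn; first exact: wcoef0.
by rewrite wcoef_is_linear xn // yn // mulr0 addr0.
Qed.

Lemma tdeg_le_subspace n : subspace (@tdeg_le K V n).
Proof.
split=> [|a x y /tdeg_leP xn /tdeg_leP yn]; apply/tdeg_leP => s sn.
  exact: wcoef0.
by rewrite wcoef_is_linear xn // yn // mulr0 addr0.
Qed.

Lemma tdeg_mon s : tdeg (size s) (mon s).
Proof.
by apply/tdegP => t; rewrite wcoef_mon; case: (s =P t) => // ->; rewrite eqxx.
Qed.

Lemma tdeg_le_mon n s : (size s <= n)%N -> tdeg_le n (mon s).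
Proof.
move=> sn; apply/tdeg_leP => t; rewrite wcoef_mon; case: eqP => // <-.
by rewrite ltnNge sn.
Qed.

Lemma tdegW n x : tdeg n x -> tdeg_le n x.
Proof.
by move=> /tdegP xn; apply/tdeg_leP => s ns; apply: xn; rewrite neq_ltn ns orbT.
Qed.

Lemma tdeg_leW m n x : (m <= n)%N -> tdeg_le m x -> tdeg_le n x.
Proof.
move=> mn /tdeg_leP xm; apply/tdeg_leP => s ns; apply: xm.
exact: leq_ltn_trans ns.
Qed.

Lemma tdeg_ind n (W : set T) x : subspace W ->
  (forall s, size s = n -> W (mon s)) -> tdeg n x -> W x.
Proof.
move=> sW Wm /tdegP xn; apply: mon_ind => // s; apply: contra_neqP => sn.
by apply: xn; apply/eqP => /Wm.
Qed.

Lemma tdeg_le_ind n (W : set T) x : subspace W ->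
  (forall s, (size s <= n)%N -> W (mon s)) -> tdeg_le n x -> W x.
Proof.
move=> sW Wm /tdeg_leP xn; apply: mon_ind => // s; apply: contra_neqP => sn.
by apply: xn; rewrite ltnNge; apply/negP => /Wm.
Qed.

Lemma tdegM m n x y : tdeg m x -> tdeg n y -> tdeg (m + n) (x * y).
Proof.
move=> xm yn; have sW := tdeg_subspace (m + n).
move: xm; apply: (tdeg_ind (subspace_mulr y sW)) => s sm /=.
move: yn; apply: (tdeg_ind (subspace_mull (mon s) sW)) => t tn /=.
by rewrite monM -sm -tn -size_cat; apply: tdeg_mon.
Qed.

Lemma tdeg_leM m n x y : tdeg_le m x -> tdeg_le n y -> tdeg_le (m + n) (x * y).
Proof.
move=> xm yn; have sW := tdeg_le_subspace (m + n).
move: xm; apply: (tdeg_le_ind (subspace_mulr y sW)) => s sm /=.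
move: yn; apply: (tdeg_le_ind (subspace_mull (mon s) sW)) => t tn /=.
by rewrite monM; apply: tdeg_le_mon; rewrite size_cat leq_add.
Qed.

Lemma wcoef_hpart n s x : wcoef s (hpart n x) = if size s == n then wcoef s x else 0.
Proof.
rewrite !wcoefE -tprojE /tproj raddf_sum /=.
rewrite (eq_bigr (fun w : word V => x@_w *+ (w == FMonom s))); last first.
  by move=> w _; rewrite mcoeffU.
have [sx|sx] := boolP (FMonom s \in msupp x); last first.
  rewrite mcoeff_outdom // if_same big_seq_cond big1 // => w /andP[wx _].
  by case: eqP wx sx => [->|]; [move=> ->|rewrite mulr0n].
case: ifP => sn.
  rewrite (big_rem (FMonom s)) //= sn eqxx mulr1n big_seq_cond big1 ?addr0 //.
  move=> w; rewrite mem_rem_uniq ?fset_uniq // inE => /andP[/andP[/negPf -> _] _].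
  by rewrite mulr0n.
rewrite big1 // => w wn; case: (w =P FMonom s) wn => [->|_ _].
  by rewrite fdegE /= sn.
by rewrite mulr0n.
Qed.

Lemma hpart_is_linear n a x y : hpart n (a *: x + y) = a *: hpart n x + hpart n y.
Proof.
apply: wcoefP => s.
rewrite wcoef_hpart !wcoef_is_linear !wcoef_hpart.
by case: ifP => _; rewrite ?wcoef_is_linear // mulr0 addr0.
Qed.
HB.instance Definition _ n :=
  GRing.isLinear.Build K T T *:%R (hpart n) (hpart_is_linear n).

Lemma hpartD n x y : hpart n (x + y) = hpart n x + hpart n y.
Proof. exact: linearD. Qed.

Lemma hpartB n x y : hpart n (x - y) = hpart n x - hpart n y.
Proof. exact: linearB. Qed.

Lemma hpart0 n : hpart n 0 = 0. Proof. exact: linear0. Qed.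

Lemma tdeg_hpart n x : tdeg n (hpart n x).
Proof. by apply/tdegP => s /negPf sn; rewrite wcoef_hpart sn. Qed.

Lemma hpart_tdeg m n x : tdeg m x -> hpart n x = if m == n then x else 0.
Proof.
move=> /tdegP xm; apply: wcoefP => s; rewrite wcoef_hpart.
case: eqP => [sn|/eqP sn]; case: eqP => [mn|/eqP mn] //; rewrite ?wcoef0 //.
  by apply: xm; rewrite sn eq_sym.
by rewrite xm // mn.
Qed.

Lemma hpart_lt m n x : (m < n)%N -> tdeg_le m x -> hpart n x = 0.
Proof.
move=> mn /tdeg_leP xm; apply: wcoefP => s; rewrite wcoef_hpart wcoef0.
by case: eqP => // sn; rewrite xm // sn.
Qed.

Lemma hpart_ident n x : tdeg n x -> hpart n x = x.
Proof. by move=> /(hpart_tdeg n) ->; rewrite eqxx. Qed.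

Lemma hpart0_le x : tdeg_le 0 x -> hpart 0 x = x.
Proof.
move=> /tdeg_leP x0; apply: wcoefP => s; rewrite wcoef_hpart.
by case: eqP => // /eqP; rewrite -lt0n => /x0.
Qed.

Lemma tdeg_leB n x : tdeg_le n.+1 x -> tdeg_le n (x - hpart n.+1 x).
Proof.
move=> /tdeg_leP xn; apply/tdeg_leP => s sn; rewrite wcoefB wcoef_hpart.
case: eqP => [_|sn1]; first by rewrite subrr.
by rewrite subr0 xn // ltn_neqAle sn andbT; apply/eqP => /esym.
Qed.

Lemma tdeg_le_lt n x : tdeg_le n.+1 x -> hpart n.+1 x = 0 -> tdeg_le n x.
Proof. by move=> /tdeg_leB + x0; rewrite x0 subr0. Qed.

Lemma exists_tdeg_le x : exists n, tdeg_le n x.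
Proof.
exists (\max_(w <- msupp x) fdeg w)%N => w wx.
exact: (@leq_bigmax_seq _ _ xpredT (@fdeg _)).
Qed.

Lemma tdeg_le_sum n x : tdeg_le n x -> x = \sum_(i < n.+1) hpart i x.
Proof.
move=> /tdeg_leP xn; apply: wcoefP => s; rewrite linear_sum /=.
have [ns|sn] := ltnP n (size s).
  rewrite xn // big1 // => i _; rewrite wcoef_hpart; case: eqP => // si.
  by rewrite xn.
rewrite (bigD1 (Ordinal (n:=n.+1) (m:=size s) sn)) //= big1 => [|i /eqP si].
  by rewrite wcoef_hpart eqxx addr0.
rewrite wcoef_hpart; case: eqP => // ssi; case: si.
by apply: val_inj; rewrite /= ssi.
Qed.

(** The letters freely generate T_+ as a right and as a left T-module; [lcut i] and [rcut i] are the
    coordinates. For [x] in T_+ and a two-sided ideal I, [x] lies in T_+ I if and only if every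
    [lcut i x] lies in I. *)
Definition lcut : 'I_d -> T -> T := locked (fun i =>
  lext (fun w : {fmonom 'I_d} =>
    if (w : seq 'I_d) is j :: s then (j == i)%:R *: mon s else 0)).
Definition rcut : 'I_d -> T -> T := locked (fun i =>
  lext (fun w : {fmonom 'I_d} =>
    if rev w is j :: s then (j == i)%:R *: mon (rev s) else 0)).

Lemma lcut_is_linear i a x y : lcut i (a *: x + y) = a *: lcut i x + lcut i y.
Proof. by rewrite /lcut -lock; apply: lext_is_linear. Qed.
Lemma rcut_is_linear i a x y : rcut i (a *: x + y) = a *: rcut i x + rcut i y.
Proof. by rewrite /rcut -lock; apply: lext_is_linear. Qed.
HB.instance Definition _ i :=
  GRing.isLinear.Build K T T *:%R (lcut i) (lcut_is_linear i).
HB.instance Definition _ i :=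
  GRing.isLinear.Build K T T *:%R (rcut i) (rcut_is_linear i).

Lemma lcut_mon i j s : lcut i (mon (j :: s)) = (j == i)%:R *: mon s.
Proof. by rewrite /lcut -lock (monE (j :: s)) lextU. Qed.

Lemma rcut_mon i j s : rcut i (mon (rcons s j)) = (j == i)%:R *: mon s.
Proof. by rewrite /rcut -lock (monE (rcons s j)) lextU /= rev_rcons revK. Qed.

Lemma sum_delta (E : lmodType K) (F : 'I_d -> E) j :
  \sum_i (j == i)%:R *: F i = F j.
Proof.
rewrite (bigD1 j) //= eqxx scale1r big1 ?addr0 // => i /negPf ij.
by rewrite eq_sym ij scale0r.
Qed.

Lemma sum_lcut x : wcoef [::] x = 0 -> x = \sum_i letter i * lcut i x.
Proof.
move=> x0; apply: (@linear_mon_eq _ idfun (fun x => \sum_i letter i * lcut i x)) => //.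
  move=> a y z; rewrite scaler_sumr -big_split; apply: eq_bigr => i _ /=.
  by rewrite linearP mulrDr scalerAr.
case=> [/negP|j s _]; first by rewrite x0 eqxx.
under eq_bigr do rewrite lcut_mon -scalerAr.
by rewrite sum_delta -mon_cons.
Qed.

Lemma sum_rcut x : wcoef [::] x = 0 -> x = \sum_i rcut i x * letter i.
Proof.
move=> x0; apply: (@linear_mon_eq _ idfun (fun x => \sum_i rcut i x * letter i)) => //.
  move=> a y z; rewrite scaler_sumr -big_split; apply: eq_bigr => i _ /=.
  by rewrite linearP mulrDl scalerAl.
case/lastP=> [/negP|s j _]; first by rewrite x0 eqxx.
under eq_bigr do rewrite rcut_mon -scalerAl.
by rewrite sum_delta -mon_rcons.
Qed.

Lemma lcutM i x y : wcoef [::] x = 0 -> lcut i (x * y) = lcut i x * y.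
Proof.
move=> x0; apply: (@linear_mon_eq _ (fun x => lcut i (x * y)) (fun x => lcut i x * y)).
- by move=> a u v; rewrite mulrDl -scalerAl linearP.
- by move=> a u v; rewrite linearP mulrDl scalerAl.
case=> [/negP|j s _]; first by rewrite x0 eqxx.
apply: (@linear_mon_eq _ (fun y => lcut i (mon (j :: s) * y))
  (fun y => lcut i (mon (j :: s)) * y)).
- by move=> a u v; rewrite mulrDr -scalerAr linearP.
- by move=> a u v; rewrite mulrDr scalerAr.
by move=> t _; rewrite monM !lcut_mon -scalerAl monM.
Qed.

Lemma rcutM i x y : wcoef [::] y = 0 -> rcut i (x * y) = x * rcut i y.
Proof.
move=> y0; apply: (@linear_mon_eq _ (fun y => rcut i (x * y)) (fun y => x * rcut i y)).
- by move=> a u v; rewrite mulrDr -scalerAr linearP.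
- by move=> a u v; rewrite linearP mulrDr scalerAr.
case/lastP=> [/negP|s j _]; first by rewrite y0 eqxx.
apply: (@linear_mon_eq _ (fun x => rcut i (x * mon (rcons s j)))
  (fun x => x * rcut i (mon (rcons s j)))).
- by move=> a u v; rewrite mulrDl -scalerAl linearP.
- by move=> a u v; rewrite mulrDl scalerAl.
by move=> t _; rewrite monM -rcons_cat !rcut_mon -scalerAr monM.
Qed.

Lemma lcut_deg n i x : tdeg n.+1 x -> tdeg n (lcut i x).
Proof.
apply: (@tdeg_ind n.+1 [set x | tdeg n (lcut i x)]).
  by apply: subspace_preimage; [exact: linearP|exact: tdeg_subspace].
move=> [//|j s] [<-] /=; rewrite lcut_mon.
exact/(subZ (tdeg_subspace _))/tdeg_mon.
Qed.

Lemma rcut_deg n i x : tdeg n.+1 x -> tdeg n (rcut i x).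
Proof.
apply: (@tdeg_ind n.+1 [set x | tdeg n (rcut i x)]).
  by apply: subspace_preimage; [exact: linearP|exact: tdeg_subspace].
case/lastP=> [//|s j]; rewrite size_rcons => -[<-] /=; rewrite rcut_mon.
exact/(subZ (tdeg_subspace _))/tdeg_mon.
Qed.

Lemma tincl_basis (i : 'I_d) : tincl (vbasis {:V})`_i = letter i.
Proof.
rewrite /tincl (bigD1 i) //= big1 => [|j ji].
  by rewrite (coord_free i i (basis_free (vbasisP _))) eqxx scale1r addr0 /letter monE fmuE.
by rewrite (coord_free i j (basis_free (vbasisP _))) eq_sym (negPf ji) scale0r.
Qed.

Lemma tincl_is_linear : linear (@tincl K V).
Proof.
move=> a u v; rewrite scaler_sumr -big_split; apply: eq_bigr => i _ /=.
by rewrite linearP /= scalerDl scalerA.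
Qed.

Lemma tdeg_tincl (v : V) : tdeg 1 (tincl v).
Proof.
apply: (sub_sum (tdeg_subspace 1)) => i.
apply: (subZ (tdeg_subspace _)); rewrite fmuE -monE; exact: (@tdeg_mon [:: i]).
Qed.

Lemma tdeg1_tincl x : tdeg 1 x -> exists v : V, x = tincl v.
Proof.
apply: (@tdeg_ind 1 [set x | exists v : V, x = tincl v]).
  split=> [|a _ _ [u ->] [v ->]]; last by exists (a *: u + v); rewrite tincl_is_linear.
  by exists 0; rewrite /tincl big1 // => i _; rewrite linear0 scale0r.
by move=> [|i [|]] //= _; exists (vbasis {:V})`_i; rewrite tincl_basis.
Qed.

(** [wcoef [::]] is the augmentation of T; throughout, [wcoef [::] x = 0] expresses membership in
    T_+. *)
Lemma wcoef_nilM x y : wcoef [::] (x * y) = wcoef [::] x * wcoef [::] y.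
Proof.
apply: (@linear_mon_eq K^o (fun x => wcoef [::] (x * y))
  (fun x => wcoef [::] x * wcoef [::] y)).
- by move=> a u v; rewrite mulrDl -scalerAl linearP.
- by move=> a u v; rewrite linearP mulrDl /= -mulrA.
move=> s _; apply: (@linear_mon_eq K^o (fun y => wcoef [::] (mon s * y))
  (fun y => wcoef [::] (mon s) * wcoef [::] y)).
- by move=> a u v; rewrite mulrDr -scalerAr linearP.
- by move=> a u v; rewrite linearP mulrDr /= mulrCA.
move=> t _; rewrite monM !wcoef_mon -natrM mulnb.
by case: s.
Qed.

End TensorAlgebra.

(** * The third Tor space *)

Lemma alternating_sum2 (K : fieldType) (E : lmodType K) (f : 'I_2 -> E) :
  \sum_(j < 2) (-1) ^+ j *: f j = f ord0 - f ord_max.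
Proof.
rewrite !big_ord_recl big_ord0 addr0 expr0 scale1r expr1 scaleN1r.
by congr (_ - f _); apply: val_inj.
Qed.

Lemma alternating_sum3 (K : fieldType) (E : lmodType K) (f : 'I_3 -> E) :
  \sum_(j < 3) (-1) ^+ j *: f j = f ord0 - f (lift ord0 ord0) + f ord_max.
Proof.
rewrite !big_ord_recl big_ord0 addr0 expr0 scale1r expr1 scaleN1r sqrrN expr1n.
rewrite scale1r addrA; congr (_ - f _ + f _); exact: val_inj.
Qed.

Lemma trilinear_aux (K : fieldType) (B : algType K) c (x y u v w X U : B) :
  X = c *: x + y -> U = c *: u + v ->
  (X - U) * w = c *: ((x - u) * w) + (y - v) * w.
Proof. by move=> -> ->; rewrite opprD addrACA -scalerBr mulrDl scalerAl. Qed.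

(** A compound letter stands for the value of the section at a product in A; [abc' = abc] is
    associativity of A. The left side is the [defect] of the boundary of [a|b|c|e], the right side
    an element of T_+ I T_+ minus one of I^2. *)
Lemma boundary_aux (K : fieldType) (B : algType K) (a b c e ab bc ce abc abc' : B) :
  abc' = abc ->
  (ab * c - abc) * e - (a * bc - abc') * e + (a * b - ab) * ce =
  a * (b * c - bc) * e - (a * b - ab) * (c * e - ce).
Proof.
move=> ->; have E (p q r u v w : B) :
    p - q - (r - q) + (u - v) = w - r - (w - u - (p - v)).
  have -> : p - q - (r - q) = p - r by rewrite opprB addrA subrK.
  have -> : w - r - (w - u - (p - v)) = u - r + (p - v).
    rewrite opprB opprB addrCA [w - r]addrC (addrACA (- r)) subrr addr0.
    by rewrite addrC [- r + u]addrC.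
  by rewrite addrACA [RHS]addrACA (addrC p).
by rewrite !(mulrBl, mulrBr) !mulrA; apply: E.
Qed.

(** The terms [w i j] with the same [j] share the right factor [l j], so only their sums over [i]
    enter. *)
Lemma double_sum_aux (B : pzRingType) (J : finType) (l : J -> B) (y s w : J -> J -> B) :
  (forall j, \sum_i w i j = 0) ->
  \sum_i \sum_j l i * y i j * l j - \sum_i \sum_j (l i * s i j - w i j) * l j =
  \sum_i \sum_j l i * (y i j - s i j) * l j.
Proof.
move=> w0; transitivity (\sum_i \sum_j l i * (y i j - s i j) * l j
    + \sum_j \sum_i w i j * l j).
  rewrite [X in _ = _ + X]exchange_big -sumrB -big_split; apply: eq_bigr => i _.
  rewrite -sumrB -big_split; apply: eq_bigr => j _ /=.
  by rewrite !(mulrBl, mulrBr) opprB addrA addrAC.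
by rewrite [X in _ + X]big1 ?addr0 // => j _; rewrite -mulr_suml w0 mul0r.
Qed.

Section BarComplex.
Context {K : fieldType} {B : algType K} {X : set B}.
Local Notation A := (quotient_alg X).
Local Notation pi := (aproj X).

Definition tup n (s : seq A) : {ffun 'I_n -> A} := [ffun k : 'I_n => nth 0 s k].
Definition barsym n : seq A -> bar X n := locked (fun s => << tup n s >>).

Lemma barsymE n s : barsym n s = << tup n s >>. Proof. by rewrite /barsym -lock. Qed.

Lemma ffun_ord_ext n (f g : {ffun 'I_n -> A}) :
  (forall k : 'I_n, f k = g k) -> f = g.
Proof. by move=> fg; apply/ffunP. Qed.

Lemma bar_diffE n (z : bar X n.+1) : bar_diff z =
  lext (fun t => \sum_(j < n) (-1) ^+ j *: (<< bar_face j t >> : bar X n)) z.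
Proof.
rewrite lextE; apply: eq_bigr => t _; rewrite scaler_sumr; apply: eq_bigr => j _.
by rewrite scalerA.
Qed.

Lemma bar_diff_linear n : linear (@bar_diff K B X n.+1).
Proof. by move=> a x y; rewrite !bar_diffE lext_is_linear. Qed.

Lemma bar_diff3 a b c :
  bar_diff (barsym 3 [:: a; b; c]) = barsym 2 [:: a * b; c] - barsym 2 [:: a; b * c].
Proof.
have f0 : bar_face ord0 (tup 3 [:: a; b; c]) = tup 2 [:: a * b; c].
  by apply: ffun_ord_ext => -[[|[|k]] kl] //; rewrite !ffunE.
have f1 : bar_face ord_max (tup 3 [:: a; b; c]) = tup 2 [:: a; b * c].
  by apply: ffun_ord_ext => -[[|[|k]] kl] //; rewrite !ffunE.
by rewrite bar_diffE !barsymE lextU alternating_sum2 f0 f1.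
Qed.

Lemma bar_diff4 a b c e : bar_diff (barsym 4 [:: a; b; c; e]) =
  barsym 3 [:: a * b; c; e] - barsym 3 [:: a; b * c; e] + barsym 3 [:: a; b; c * e].
Proof.
have f0 : bar_face ord0 (tup 4 [:: a; b; c; e]) = tup 3 [:: a * b; c; e].
  by apply: ffun_ord_ext => -[[|[|[|k]]] kl] //; rewrite !ffunE.
have f1 : bar_face (lift ord0 ord0) (tup 4 [:: a; b; c; e]) =
    tup 3 [:: a; b * c; e].
  by apply: ffun_ord_ext => -[[|[|[|k]]] kl] //; rewrite !ffunE.
have f2 : bar_face ord_max (tup 4 [:: a; b; c; e]) = tup 3 [:: a; b; c * e].
  by apply: ffun_ord_ext => -[[|[|[|k]]] kl] //; rewrite !ffunE.
by rewrite bar_diffE !barsymE lextU alternating_sum3 f0 f1 f2.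
Qed.

Local Notation q2 := (qproj (@multilin K B X 2)).

Lemma bar2_linearl b : linear (fun u => q2 (barsym 2 [:: u; b])).
Proof.
move=> c x y; rewrite -linearZ -linearD; apply/qprojP; apply: sub_span.
have E u : set_coord (tup 2 [:: 0; b]) ord0 u = tup 2 [:: u; b].
  by apply: ffun_ord_ext => -[[|[|k]] kl] //; rewrite !ffunE.
by exists (tup 2 [:: 0; b]), ord0, c, x, y; rewrite !E !barsymE.
Qed.

Lemma bar2_linearr a : linear (fun u => q2 (barsym 2 [:: a; u])).
Proof.
move=> c x y; rewrite -linearZ -linearD; apply/qprojP; apply: sub_span.
have E u : set_coord (tup 2 [:: a; 0]) ord_max u = tup 2 [:: a; u].
  by apply: ffun_ord_ext => -[[|[|k]] kl] //; rewrite !ffunE.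
by exists (tup 2 [:: a; 0]), ord_max, c, x, y; rewrite !E !barsymE.
Qed.

(** By bilinearity the boundary collects into the symbols [sum_i l_i y_ij|l_j] and
    [l_i|sum_j y_ij l_j], each of which has an entry that is zero in A. *)
Lemma bar_cycle_condition (J : finType) (l : J -> B) (y : J -> J -> B) :
  (forall j, pi (\sum_i l i * y i j) = 0) ->
  (forall i, pi (\sum_j y i j * l j) = 0) ->
  span (@multilin K B X 2)
    (bar_diff (\sum_i \sum_j barsym 3 [:: pi (l i); pi (y i j); pi (l j)])).
Proof.
move=> yl yr; rewrite -[bar_diff _]subr0; apply/qprojP.
rewrite (linear_bigsum _ _ (@bar_diff_linear 2)).
have -> : \sum_i bar_diff (\sum_j barsym 3 [:: pi (l i); pi (y i j); pi (l j)]) =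
  (\sum_j \sum_i barsym 2 [:: pi (l i * y i j); pi (l j)]) -
  \sum_i \sum_j barsym 2 [:: pi (l i); pi (y i j * l j)].
  rewrite exchange_big -sumrB; apply: eq_bigr => i _.
  rewrite (linear_bigsum _ _ (@bar_diff_linear 2)) -sumrB; apply: eq_bigr => j _.
  by rewrite bar_diff3 !rmorphM.
rewrite linearB linear0 [X in X - _](_ : _ = 0); last first.
  rewrite linear_sum big1 // => j _; rewrite linear_sum /=.
  rewrite -(linear_bigsum _ _ (bar2_linearl (pi (l j)))) -linear_sum /= yl.
  exact: linear_at0 (bar2_linearl _).
rewrite sub0r linear_sum big1 ?oppr0 // => i _; rewrite linear_sum /=.
rewrite -(linear_bigsum _ _ (bar2_linearr (pi (l i)))) -linear_sum /= yr.
exact: linear_at0 (bar2_linearr _).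
Qed.

End BarComplex.

(** * From bar cycles over A to products of ideals in T *)

Section TorThree.
Context {K : fieldType} {V : vectType K}.
Local Notation T := (tensor_alg V).
Local Notation d := (\dim {:V}).
Variable I : set T.
Hypothesis idI : two_sided_ideal I.
Hypothesis lowI : forall x s, I x -> (size s <= 1)%N -> wcoef s x = 0.

Local Notation A := (quotient_alg I).
Local Notation pi := (aproj I).

Let sI : subspace I. Proof. by case: idI. Qed.
Let idealE : ideal I = I. Proof. exact: smallest_id. Qed.

Lemma low_eq0 x : I x -> tdeg_le 1 x -> x = 0.
Proof.
move=> Ix /tdeg_leP x1; apply: wcoefP => s; rewrite wcoef0.
by have [/(lowI Ix)|/x1] := leqP (size s) 1.
Qed.

Lemma proj_eq x y : pi x = pi y <-> I (x - y).
Proof. by rewrite aprojP idealE. Qed.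

Lemma proj_linear c x y : pi (c *: x + y) = c *: pi x + pi y.
Proof. by rewrite linearP. Qed.

Lemma projM x y : pi (x * y) = pi x * pi y.
Proof. exact: aprojM. Qed.

Lemma proj0 x : I x -> pi x = 0.
Proof. by move=> Ix; rewrite -(linear0 (aproj I)); apply/proj_eq; rewrite subr0. Qed.

(* I^2 + T_+ I T_+: Tor_3 is the quotient of (T_+ I) /\ (I T_+) by this space. *)
Definition decomposable3 : set T :=
  span ([set z | exists a b x,
          [/\ wcoef [::] a = 0, wcoef [::] b = 0, I x & z = a * x * b]] `|`
        [set z | exists x y, [/\ I x, I y & z = x * y]]).

Local Notation J := decomposable3.
Let sJ : subspace J. Proof. exact: span_subspace. Qed.

Lemma decomposable3_mid a x b : wcoef [::] a = 0 -> wcoef [::] b = 0 -> I x -> J (a * x * b).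
Proof. by move=> *; apply: sub_span; left; exists a, b, x. Qed.

Lemma decomposable3_sq x y : I x -> I y -> J (x * y).
Proof. by move=> *; apply: sub_span; right; exists x, y. Qed.

(** The section can be the identity on V because I has no nonzero element of degree at most 1.
    Thanks to this normalization the [defect] of [l_i|y|l_j] has the letters themselves as outer
    factors. *)
Lemma exists_section : exists sg : A -> T, [/\ linear sg,
  forall x, I (x - sg (pi x)) & forall x, tdeg 1 x -> sg (pi x) = x].
Proof.
have [|N [Nl NI N0 N1]] := exists_projection sI (tdeg_subspace 1).
  by move=> x [/tdegW x1 Ix]; apply: low_eq0.
have NE x y : I (x - y) -> N x = N y.
  move=> /N0; rewrite [x - y]addrC -scaleN1r Nl scaleN1r addrC.
  exact: subr0_eq.
have sE x : N (qrepr (ideal I) (pi x)) = N x.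
  apply: NE; suff : ideal I (qrepr (ideal I) (pi x) - x) by rewrite [X in X _]idealE.
  by rewrite -[X in X _]span_ideal; apply: qprojK.
(* [qrepr] is not linear, but two representatives differ by an element of I, which [N] sends to
   0. *)
exists (N \o qrepr (ideal I)); split=> [a|x|x x1] /=.
- apply: aproj_ind => x; apply: aproj_ind => y.
  by rewrite -proj_linear /= !sE Nl.
- by rewrite sE.
- by rewrite sE N1.
Qed.

Section Splitting.
Variable sg : A -> T.
Hypotheses (sgL : linear sg) (sgP : forall x, I (x - sg (pi x))).
Hypothesis (sg1 : forall x, tdeg 1 x -> sg (pi x) = x).

HB.instance Definition _ := GRing.isLinear.Build K A T *:%R sg sgL.

Lemma section_proj a : pi (sg a) = a.
Proof.
move: a; apply: aproj_ind => x; apply/esym/proj_eq; exact: sgP.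
Qed.

Lemma section_mul a b : I (sg a * sg b - sg (a * b)).
Proof. by apply/proj_eq; rewrite projM !section_proj. Qed.

(* Lifting the boundary [ab|c] - [a|bc] of a cycle along sg, the part in I (x) T_+
   is (sg a sg b - sg (a b)) (x) sg c, whose product in T is this value. *)
Definition defect (t : {ffun 'I_3 -> A}) : T :=
  (sg (t ord0) * sg (t (lift ord0 ord0)) - sg (t ord0 * t (lift ord0 ord0)))
  * sg (t ord_max).

Local Notation Defect := (lext defect : bar I 3 -> T).

Lemma defect_tup a b c :
  defect (tup 3 [:: a; b; c]) = (sg a * sg b - sg (a * b)) * sg c.
Proof. by rewrite /defect !ffunE. Qed.

Lemma defect_multilin z : multilin z -> Defect z = 0.
Proof.
move=> [t [j [c [a [b ->]]]]]; apply/eqP.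
rewrite linearB subr_eq0 linearD linearZ /= !lextU; apply/eqP.
have e : t = tup 3 [:: t ord0; t (lift ord0 ord0); t ord_max].
  apply: ffun_ord_ext => -[[|[|[|k]]] kl] //; rewrite ffunE /=; congr (t _);
  exact: val_inj.
move: e; set x := t _; set y := t _; set w := t _ => ->.
case: j => [[|[|[|k]]] kl] //.
- have E u : set_coord (tup 3 [:: x; y; w]) (Ordinal kl) u = tup 3 [:: u; y; w].
    by apply: ffun_ord_ext => -[[|[|[|k]]] kl'] //; rewrite !ffunE.
  rewrite !E !defect_tup.
  apply: trilinear_aux; first by rewrite (sgL c a b) mulrDl scalerAl.
  by rewrite mulrDl -ascaleAl (sgL c).
- have E u : set_coord (tup 3 [:: x; y; w]) (Ordinal kl) u = tup 3 [:: x; u; w].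
    by apply: ffun_ord_ext => -[[|[|[|k]]] kl'] //; rewrite !ffunE.
  rewrite !E !defect_tup.
  apply: trilinear_aux; first by rewrite (sgL c a b) mulrDr scalerAr.
  by rewrite mulrDr -ascaleAr (sgL c).
- have E u : set_coord (tup 3 [:: x; y; w]) (Ordinal kl) u = tup 3 [:: x; y; u].
    by apply: ffun_ord_ext => -[[|[|[|k]]] kl'] //; rewrite !ffunE.
  by rewrite !E !defect_tup (sgL c a b) mulrDr scalerAr.
Qed.

Lemma section_aug m a : (0 < m)%N -> alg_deg I m a -> wcoef [::] (sg a) = 0.
Proof.
move=> m0 [x /tdegP xm <-].
have := lowI (sgP x) (isT : (size (@nil 'I_d) <= 1)%N).
have x0 : wcoef [::] x = 0 by apply: xm; rewrite eq_sym -lt0n.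
by rewrite wcoefB x0 sub0r => /eqP; rewrite oppr_eq0 => /eqP.
Qed.

(** [boundary_aux] splits the value. The outer entries of a normalized chain have positive degree,
    so their lifts lie in T_+ and the first term in T_+ I T_+. *)
Lemma defect_boundary n z : bar_boundary (alg_deg I) (i:=3) n z -> J (Defect z).
Proof.
move=> [w wn <-]; move: w wn.
have sW : subspace [set w : bar I 4 | J (Defect (bar_diff w))].
  apply: (@subspace_preimage K (bar I 4) T (fun w => Defect (bar_diff w))) => //.
  by move=> c x y; rewrite bar_diff_linear linearP.
apply: (span_sub sW) => _ [m [t [mt _ ->]]].
suff : J (Defect (bar_diff (<< t >> : bar I 4))) by [].
have e : t = tup 4 [:: t ord0; t (lift ord0 ord0); t (lift ord0 (lift ord0 ord0));
   t ord_max].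
  apply: ffun_ord_ext => -[[|[|[|[|k]]]] kl] //; rewrite ffunE /=; congr (t _);
  exact: val_inj.
have [m0 G0] := mt ord0; have [m3 G3] := mt ord_max.
have t0 := section_aug m0 G0; have t3 := section_aug m3 G3.
move: t0 t3 e; move: (t ord0) (t (lift ord0 ord0)) => a b.
move: (t (lift ord0 (lift ord0 ord0))) (t ord_max) => c e a0 e0 ->.
rewrite -barsymE bar_diff4 linearD linearB !barsymE /= !lextU !defect_tup.
apply: (eq_ind_r J _ (boundary_aux _ _ _ _ _ _ _ (congr1 sg (mulrA a b c)))).
exact: (subB sJ (decomposable3_mid a0 e0 (section_mul b c)) (decomposable3_sq (section_mul a b) (section_mul c e))).
Qed.

End Splitting.

(** Writing x as the sum of the l_i y_ij l_j gives the cycle [z], the sum of the [l_i|y_ij|l_j],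
    which is a boundary modulo multilinearity when Tor vanishes. Its [defect] then lies in [J], and
    x minus this value is the sum of the l_i (y_ij - sg (pi y_ij)) l_j, an element of T_+ I T_+. *)
Lemma decomposable3_of_Tor3 m x : (0 < m)%N ->
  Tor (alg_deg I) 3 m = [set 0] -> tdeg m x ->
  (forall i, I (lcut i x)) -> (forall i, I (rcut i x)) -> J x.
Proof.
move=> m0 tor0 xm Il Ir.
have x0 : wcoef [::] x = 0 by move/tdegP: xm; apply; rewrite eq_sym -lt0n.
have xE := sum_rcut x0.
(* In degrees 1 and 2 the [rcut j x] have degree at most 1, where I is zero. From degree 3 on the
   middle entries [y i j] have positive degree, as the normalized bar complex requires. *)
case: m m0 tor0 xm => [//|[|[|p]]] _ tor0 xm.
- rewrite xE; apply: (sub_sum sJ) => j.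
  have r1 := tdeg_leW (leq0n 1) (tdegW (rcut_deg (i:=j) xm)).
  by rewrite (low_eq0 (Ir j) r1) mul0r; apply: sub0.
- rewrite xE; apply: (sub_sum sJ) => j.
  have r1 := tdegW (rcut_deg (i:=j) xm).
  by rewrite (low_eq0 (Ir j) r1) mul0r; apply: sub0.
pose y i j := lcut i (rcut j x).
have r0 j : wcoef [::] (rcut j x) = 0 by exact: (lowI (s:=[::]) (Ir j)).
have rE j : rcut j x = \sum_i letter i * y i j by exact: sum_lcut (r0 j).
have lE i : lcut i x = \sum_j y i j * letter j.
  rewrite {1}xE (linear_bigsum _ _ (lcut_is_linear i)).
  by apply: eq_bigr => j _; apply: lcutM; apply: r0.
have yd i j : tdeg p.+1 (y i j) by exact: lcut_deg (rcut_deg xm).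
clearbody y.
have [sg [sgL sgP sg1]] := exists_section.
have letter1 (i : 'I_d) : tdeg 1 (letter i : T) by exact: (@tdeg_mon _ _ [:: i]).
pose z : bar I 3 := \sum_i \sum_j barsym 3 [:: pi (letter i); pi (y i j); pi (letter j)].
have cz : bar_cycle (alg_deg I) p.+3 z.
  split.
    apply: (sub_sum (span_subspace _)) => i.
    apply: (sub_sum (span_subspace _)) => j; apply: sub_span.
    exists (fun k : 'I_3 => nth 0%N [:: 1; p.+1; 1]%N k).
    exists (tup 3 [:: pi (letter i); pi (y i j); pi (letter j)]).
    split; last exact: barsymE.
      move=> [[|[|[|k]]] kl] //; rewrite ffunE /=; split=> //.
      - by exists (letter i).
      - by exists (y i j) => //; apply: yd.
      - by exists (letter j).
    by rewrite !big_ord_recl big_ord0 /= addn0 add1n addn1.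
  apply: bar_cycle_condition => [j|i]; apply: proj0.
    by rewrite -rE; apply: Ir.
  by rewrite -lE; apply: Il.
have qz : qproj (@multilin _ _ I 3 `|` bar_boundary (alg_deg I) p.+3) z = 0.
  have : Tor (alg_deg I) 3 p.+3 (qproj _ z) by exists z.
  by rewrite tor0.
have Jz : J (lext (defect sg) z).
  have sW : subspace [set z : bar I 3 | J (lext (defect sg) z)].
    exact: subspace_preimage (lext_is_linear _) sJ.
  apply: (span_sub sW (X := @multilin _ _ I 3 `|` bar_boundary (alg_deg I) p.+3)).
    move=> u [mu|bu]; last exact: (defect_boundary sgP bu).
    by rewrite /= (defect_multilin sgL mu); apply: sub0.
  by rewrite -[z]subr0; apply/qprojP; rewrite qz linear0.
suff [w w0 zE] : exists2 w : 'I_d -> 'I_d -> T, forall j, \sum_i w i j = 0 &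
    lext (defect sg) z =
    \sum_i \sum_j (letter i * sg (pi (y i j)) - w i j) * letter j.
  rewrite -[x](subrK (lext (defect sg) z)); apply: (subD sJ) => //.
  have xE2 : x = \sum_i \sum_j letter i * y i j * letter j.
    rewrite {1}xE exchange_big; apply: eq_bigr => j _.
    by rewrite -mulr_suml; congr (_ * _); apply: rE.
  rewrite {1}xE2 zE double_sum_aux //.
  apply: (sub_sum sJ) => i; apply: (sub_sum sJ) => j.
  by apply: decomposable3_mid; rewrite ?wcoef_mon.
(* For fixed [j] these add up to [sg] of the class of [rcut j x], which is zero because [rcut j x]
   lies in I. *)
exists (fun i j => sg (pi (letter i * y i j))).
  move=> j; rewrite -(linear_bigsum _ _ sgL).
  have piL' : linear (aproj I) by move=> c u v; exact: proj_linear.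
  rewrite -(linear_bigsum _ _ piL') -rE (proj0 (Ir j)).
  exact: linear_at0 sgL.
rewrite (linear_bigsum _ _ (lext_is_linear _)); apply: eq_bigr => i _.
rewrite (linear_bigsum _ _ (lext_is_linear _)); apply: eq_bigr => j _.
rewrite barsymE lextU defect_tup.
have E (a b c e a' c' e' : T) : a = a' -> c = c' -> e = e' ->
  (a * b - e) * c = (a' * b - e') * c' by move=> -> -> ->.
apply: E; [exact: sg1 (letter1 i)|exact: sg1 (letter1 j)|].
exact: (congr1 sg (esym (projM (letter i) (y i j)))).
Qed.

End TorThree.

(** * Syzygies and the Jacobi conditions *)

Lemma mulr_sandwich (B : pzRingType) (a b c e x : B) :
  a * (b * x * c) * e = a * b * x * (c * e).
Proof. by rewrite !mulrA. Qed.

Lemma pair_mull_linear (K : fieldType) (B : algType K) (p q w : B) :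
  linear (fun a : B => (a * p * w, a * q * w)).
Proof. by move=> c x y; rewrite !mulrDl -!scalerAl. Qed.

Lemma pair_mulr_linear (K : fieldType) (B : algType K) (p q u : B) :
  linear (fun b : B => (u * p * b, u * q * b)).
Proof. by move=> c x y; rewrite !mulrDr -!scalerAr. Qed.

Lemma mulr_split (B : pzRingType) (u r v r' w : B) :
  u * r * v * r' * w = u * r * (v * r' * w).
Proof. by rewrite !mulrA. Qed.

Lemma mulr_join (B : pzRingType) (u r v v' r' w : B) :
  u * r * v * (v' * r' * w) = u * r * (v * v') * r' * w.
Proof. by rewrite !mulrA. Qed.

Lemma liftable_aux (B : pzRingType) (u r s v r' s' w : B) :
  u * r * v * s' * w - u * s * (v * r' * w) =
  u * s * (v * (s' - r') * w) - u * (s - r) * v * s' * w.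
Proof. by rewrite !(mulrBl, mulrBr) !mulrA opprB [RHS]addrC addrA subrK. Qed.

Section Syzygies.
Context {K : fieldType} {V : vectType K}.
Local Notation T := (tensor_alg V).
Local Notation d := (\dim {:V}).
Implicit Types (x y r : T) (u w : seq 'I_d).

Variables (R : set T) (alpha : T -> T).
Hypothesis sR : subspace R.
Hypothesis Rhom : forall n x, R x -> R (hpart n x).
Hypothesis Rlow : forall r u, R r -> (size u <= 1)%N -> wcoef u r = 0.
Hypothesis alphaL : forall (a : K) x y, R x -> R y ->
  alpha (a *: x + y) = a *: alpha x + alpha y.
Hypothesis alpha_top : forall n r, R r -> tdeg n r ->
  tdeg_le n (alpha r) /\ hpart n (alpha r) = r.

Lemma alpha0 : alpha 0 = 0.
Proof.
by have := alphaL (-1) (sub0 sR) (sub0 sR); rewrite scaler0 addr0 scaleN1r addNr.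
Qed.

Lemma alphaD x y : R x -> R y -> alpha (x + y) = alpha x + alpha y.
Proof. by move=> Rx Ry; have := alphaL 1 Rx Ry; rewrite !scale1r. Qed.

Lemma Rlow0 n r : (n <= 1)%N -> R r -> tdeg n r -> r = 0.
Proof.
move=> n1 Rr /tdegP rn; apply: wcoefP => s; rewrite wcoef0.
by have [sn|/rn //] := eqVneq (size s) n; apply: Rlow => //; rewrite sn.
Qed.

Lemma alpha_le n r : R r -> tdeg_le n r ->
  tdeg_le n (alpha r) /\ hpart n (alpha r) = hpart n r.
Proof.
elim: n r => [|n IH] r Rr rn.
  have r0 := hpart0_le rn.
  by rewrite r0; apply: alpha_top => //; rewrite -r0; apply: tdeg_hpart.
have Rt := Rhom n.+1 Rr; have [tn tE] := alpha_top Rt (@tdeg_hpart _ _ n.+1 r).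
have Rb := subB sR Rr Rt; have [bn _] := IH _ Rb (tdeg_leB rn).
have -> : alpha r = alpha (r - hpart n.+1 r) + alpha (hpart n.+1 r).
  by rewrite -alphaD // subrK.
split; first by apply: (subD (tdeg_le_subspace _)) => //; apply: tdeg_leW bn.
by rewrite linearD /= (hpart_lt (ltnSn n) bn) add0r tE.
Qed.

(** The top part of [r] survives in [alpha r], so [alpha] cannot lower the degree. This is what
    identifies the filtration of alpha(R) with that of R in [jacobi_spaceE]. *)
Lemma alpha_upto n r : R r -> tdeg_le n (alpha r) -> tdeg_le n r.
Proof.
move=> Rr an; have [m rm] := exists_tdeg_le r.
elim: m rm => [|m IH] rm; first exact: tdeg_leW rm.
have [mn|nm] := leqP m.+1 n; first exact: tdeg_leW rm.
apply: IH; apply: tdeg_le_lt => //.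
by have [_ <-] := alpha_le Rr rm; apply: hpart_lt an.
Qed.

(* With Q = alpha(R), [syz_le n] is Q_n; see [jacobi_spaceE]. *)
Definition syz_le n : set T :=
  span [set z | exists u s r w,
    [/\ R r, tdeg s r, (size u + s + size w <= n)%N & z = mon u * alpha r * mon w]].

(* The image in T x T of the words u (x) r (x) w of T (x) R (x) T of total degree
   n satisfying p, under evaluation of r and of alpha r; an element (0, y) stands
   for the value y under alpha of a syzygy of R. *)
Definition syz (p : seq 'I_d -> seq 'I_d -> bool) n : set (T * T) :=
  span [set z | exists u s r w,
    [/\ R r, tdeg s r, (size u + s + size w)%N = n, p u w &
     z = (mon u * r * mon w, mon u * alpha r * mon w)]].

Local Notation D := syz_le.
Let sD n : subspace (D n). Proof. exact: span_subspace. Qed.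
Let sG p n : subspace (syz p n). Proof. exact: span_subspace. Qed.

Lemma syz_le_gen n u s r w : R r -> tdeg s r -> (size u + s + size w <= n)%N ->
  D n (mon u * alpha r * mon w).
Proof. by move=> *; apply: sub_span; exists u, s, r, w. Qed.

Lemma syz_gen (p : seq 'I_d -> seq 'I_d -> bool) n u s r w :
  R r -> tdeg s r -> (size u + s + size w)%N = n -> p u w ->
  syz p n (mon u * r * mon w, mon u * alpha r * mon w).
Proof. by move=> *; apply: sub_span; exists u, s, r, w. Qed.

Lemma syz_leW m n x : (m <= n)%N -> D m x -> D n x.
Proof.
move=> mn; apply: span_mono => _ [u [s [r [w [? ? sm ->]]]]].
by exists u, s, r, w; split=> //; apply: leq_trans mn.
Qed.

Lemma syz_leMl u n x : D n x -> D (size u + n) (mon u * x).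
Proof.
apply: (span_sub (subspace_mull (mon u) (sD (size u + n)))).
move=> _ [v [s [r [w [Rr rs sn ->]]]]] /=; rewrite !mulrA monM.
by apply: (syz_le_gen Rr rs); rewrite size_cat -!addnA leq_add2l addnA.
Qed.

Lemma syz_leMr w n x : D n x -> D (n + size w) (x * mon w).
Proof.
apply: (span_sub (subspace_mulr (mon w) (sD (n + size w)))).
move=> _ [u [s [r [v [Rr rs sn ->]]]]] /=; rewrite -mulrA monM.
by apply: (syz_le_gen Rr rs); rewrite size_cat addnA leq_add2r.
Qed.

Lemma syz_le_prod i j k n a r b : R r -> tdeg_le i a -> tdeg_le j r -> tdeg_le k b ->
  (i + j + k <= n)%N -> D n (a * alpha r * b).
Proof.
move=> Rr ai rj bk ijk.
have Wb := subspace_mulr b (sD n).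
move: ai; apply: (tdeg_le_ind (subspace_mulr (alpha r) Wb)) => u ui.
move: bk; apply: (tdeg_le_ind (subspace_mull (mon u * alpha r) (sD n))) => w wk.
suff : D n (mon u * alpha r * mon w) by [].
(* [alpha] is additive on R only, so membership in R is carried along the sum of homogeneous
   parts. *)
suff [Rr' ] : R r /\ D n (mon u * alpha r * mon w) by [].
rewrite (tdeg_le_sum rj).
apply: (@big_ind _ (fun r => R r /\ D n (mon u * alpha r * mon w))).
- by split; [exact: (sub0 sR)|rewrite alpha0 mulr0 mul0r; exact: (sub0 (sD n))].
- move=> x y [Rx Dx] [Ry Dy]; split; first exact: (subD sR).
  by rewrite (alphaD Rx Ry) mulrDr mulrDl; apply: (subD (sD n)).
move=> l _; split; first exact: Rhom.
apply: (syz_le_gen (Rhom l Rr) (@tdeg_hpart _ _ l r)).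
apply: leq_trans ijk; apply: leq_add => //; apply: leq_add => //.
by rewrite -ltnS.
Qed.

Lemma jacobi_spaceE n : jacobi_space (alpha @` R) n = D n.
Proof.
apply/seteqP; split.
- apply: span_sub => // x [[[i j] k] /= ijk]; apply: span_sub => // _ [z [b [zij bk ->]]].
  move: zij; apply: (span_sub (subspace_mulr b (sD n))).
  move=> _ [a [q [ai [[r Rr <-] qj] ->]]] /=.
  by apply: (syz_le_prod Rr ai (alpha_upto Rr qj) bk); rewrite ijk.
- apply: span_sub; first exact: span_subspace.
  move=> _ [u [s [r [w [Rr rs sn ->]]]]].
  (* The middle degree takes up the slack between [size u + s + size w] and [n]. *)
  apply: sub_span; exists (size u, n - size u - size w, size w)%N => /=.
    by rewrite subnAC subnKC ?subnK //; move: sn; lia.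
  apply: sub_span; exists (mon u * alpha r), (mon w); split=> //; last exact: tdegW (@tdeg_mon _ _ w).
  apply: sub_span; exists (mon u), (alpha r); split=> //; first exact: tdegW (@tdeg_mon _ _ u).
  split; first by exists r.
  by apply: tdeg_leW (alpha_top Rr rs).1; move: sn; lia.
Qed.

Lemma fst_linear : linear (@fst T T). Proof. by []. Qed.
Lemma snd_linear : linear (@snd T T). Proof. by []. Qed.

Lemma alpha_sub n r : R r -> tdeg n.+1 r -> tdeg_le n (alpha r - r).
Proof.
move=> Rr rn; have [an aE] := alpha_top Rr rn; apply: tdeg_le_lt.
  exact: (subB (tdeg_le_subspace n.+1) an (tdegW rn)).
by rewrite linearB /= aE (hpart_ident rn) subrr.
Qed.

(** Replacing r by alpha r changes u r w in lower degrees only. In particular a pair [(0, y)] has no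
    part of degree n in [y]. *)
Lemma syz_top p n z : syz p n z ->
  [/\ tdeg n z.1, tdeg_le n z.2 & hpart n z.2 = z.1].
Proof.
move=> zG.
pose W := [set z : T * T | tdeg n z.1] `&`
  ([set z : T * T | tdeg_le n z.2] `&` [set z : T * T | hpart n z.2 = z.1]).
suff : W z by case=> ? [? ?].
move: z zG; apply: span_sub.
  apply: subspaceI; first exact: subspace_preimage fst_linear (tdeg_subspace n).
  apply: subspaceI; first exact: subspace_preimage snd_linear (tdeg_le_subspace n).
  apply: subspace_eq fst_linear => a x y; exact: linearP.
move=> _ [u [s [r [w [Rr rs sn _ ->]]]]].
have un := @tdeg_mon _ _ u; have wn := @tdeg_mon _ _ w.
have urw : tdeg n (mon u * r * mon w).
  by rewrite -sn; exact: tdegM (tdegM un rs) wn.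
have aurw : tdeg_le n (mon u * alpha r * mon w).
  rewrite -sn; apply: tdeg_leM (tdegW wn); apply: tdeg_leM (tdegW un) _.
  exact: (alpha_top Rr rs).1.
split; [exact: urw|split; [exact: aurw|]].
suff : hpart n (mon u * alpha r * mon w) = mon u * r * mon w by [].
(* [alpha_sub] needs a positive degree; in degree 0 both [r] and [alpha r] vanish. *)
case: s rs sn => [rs _|s rs sn].
  by rewrite (Rlow0 _ Rr rs) // alpha0 mulr0 mul0r linear0.
have nE : n = (size u + s + size w).+1 by rewrite -sn addnS addSn.
have low := tdeg_leM (tdeg_leM (tdegW un) (alpha_sub Rr rs)) (tdegW wn).
have h0 : hpart n (mon u * (alpha r - r) * mon w) = 0.
  by apply: hpart_lt low; rewrite nE.
rewrite -[RHS](hpart_ident urw) -[RHS]add0r -h0 -hpartD; congr hpart.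
by rewrite -mulrDl -mulrDr subrK.
Qed.

Lemma syz_D p n z : syz p n z -> D n z.2.
Proof.
move: z; apply: span_sub; first exact: subspace_preimage snd_linear (sD n).
move=> _ [u [s [r [w [Rr rs sn _ ->]]]]].
by apply: (syz_le_gen Rr rs); rewrite sn.
Qed.

(** The images of T (x) R (x) T, T_+ (x) R (x) T and T (x) R (x) T_+. The last two together with R
    span the first, which is how a syzygy is broken up in the induction. *)
Local Notation GA := (syz (fun _ _ => true)).
Local Notation GL := (syz (fun u _ => u != [::])).
Local Notation GR := (syz (fun _ w => w != [::])).

Lemma syz_pD p n x y x' y' :
  syz p n (x, y) -> syz p n (x', y') -> syz p n (x + x', y + y').
Proof. exact: (subD (sG p n)). Qed.

Lemma syz_pB p n x y x' y' :
  syz p n (x, y) -> syz p n (x', y') -> syz p n (x - x', y - y').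
Proof. exact: (subB (sG p n)). Qed.

Lemma syz_eq p n x x' y y' :
  x = x' -> y = y' -> syz p n (x', y') -> syz p n (x, y).
Proof. by move=> -> ->. Qed.

Lemma syz_p0 p n : syz p n (0, 0).
Proof. exact: (sub0 (sG p n)). Qed.

(** Generators of total degree at most n already lie in [D n]; only those of degree exactly n + 1
    need a lift. *)
Lemma syz_le_lift n y : D n.+1 y -> exists x y', GA n.+1 (x, y') /\ D n (y - y').
Proof.
move: y; apply: (@span_sub _ _ _ [set y | exists x y', GA n.+1 (x, y') /\ D n (y - y')]).
  split=> [|a y z [x [y' [Gy Dy]]] [x' [z' [Gz Dz]]]].
    exists 0, 0; split; first exact: syz_p0.
    by rewrite subrr; exact: (sub0 (sD n)).
  exists (a *: x + x'), (a *: y' + z'); split; first exact: ((sG _ _).2 a _ _ Gy Gz).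
  have -> : a *: y + z - (a *: y' + z') = a *: (y - y') + (z - z').
    by rewrite opprD addrACA scalerBr.
  exact: (sD n).2.
move=> _ [u [s [r [w [Rr rs sn ->]]]]].
move: sn; rewrite leq_eqVlt => /predU1P[sn|sn].
  exists (mon u * r * mon w), (mon u * alpha r * mon w); split.
    exact: syz_gen Rr rs sn _.
  by rewrite subrr; exact: (sub0 (sD n)).
exists 0, 0; split; first exact: syz_p0.
by rewrite subr0; exact: syz_le_gen Rr rs sn.
Qed.

Lemma syz_split n z : GA n z -> exists r z1 z2,
  [/\ R r, GL n z1, GR n z2 & z = (r, alpha r) + z1 + z2].
Proof.
move: z; apply: (@span_sub _ _ _ [set z | exists r z1 z2,
  [/\ R r, GL n z1, GR n z2 & z = (r, alpha r) + z1 + z2]]).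
  split=> [|a _ _ [r [z1 [z2 [Rr G1 G2 ->]]]] [r' [z1' [z2' [Rr' G1' G2' ->]]]]].
    exists 0, 0, 0; split; [exact: (sub0 sR)|exact: syz_p0|exact: syz_p0|].
    by rewrite alpha0 !addr0.
  exists (a *: r + r'), (a *: z1 + z1'), (a *: z2 + z2'); split.
  - exact: sR.2.
  - exact: ((sG _ _).2).
  - exact: ((sG _ _).2).
  have E (F : lmodType K) (p p1 p2 p' p1' p2' : F) :
      a *: (p + p1 + p2) + (p' + p1' + p2') =
      (a *: p + p') + (a *: p1 + p1') + (a *: p2 + p2').
    by rewrite !scalerDr addrACA; congr (_ + _); rewrite addrACA.
  apply: (etrans (E _ _ _ _ _ _ _)).
  have E' (x x' y z : T * T) : x = x' -> x + y + z = x' + y + z by move=> ->.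
  by apply: E'; rewrite (alphaL a Rr Rr').
move=> _ [u [s [r [w [Rr rs sn _ ->]]]]].
have [u0|u0] := eqVneq u [::]; last first.
  exists 0, (mon u * r * mon w, mon u * alpha r * mon w), 0.
  split; [exact: (sub0 sR)|exact: syz_gen Rr rs sn u0|exact: syz_p0|].
  by rewrite alpha0 addr0 add0r.
have [w0|w0] := eqVneq w [::]; last first.
  exists 0, 0, (mon u * r * mon w, mon u * alpha r * mon w).
  split; [exact: (sub0 sR)|exact: syz_p0|exact: syz_gen Rr rs sn w0|].
  by rewrite alpha0 !add0r.
exists r, 0, 0; split; [exact: Rr|exact: syz_p0|exact: syz_p0|].
by rewrite u0 w0 mon_nil !mul1r !mulr1 !addr0.
Qed.

Lemma ideal_gen u r w : R r -> ideal R (mon u * r * mon w).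
Proof. by move=> Rr; apply: (ideal_two_sided R).2; exact: sub_gen_smallest. Qed.

Lemma syz_ideal p n z : syz p n z -> ideal R z.1.
Proof.
move: z; apply: span_sub.
  exact: subspace_preimage fst_linear (ideal_two_sided R).1.
by move=> _ [u [s [r [w [Rr rs sn _ ->]]]]]; apply: ideal_gen.
Qed.

Lemma syzL_aug n z : GL n z -> wcoef [::] z.1 = 0 /\ wcoef [::] z.2 = 0.
Proof.
move: z; apply: (@span_sub _ _ _ [set z : T * T |
  wcoef [::] z.1 = 0 /\ wcoef [::] z.2 = 0]).
  split=> [|a [x y] [x' y'] [/= x0 y0] [/= x0' y0']]; first by rewrite /= !wcoef0.
  by split; rewrite /= ?wcoef_is_linear ?x0 ?y0 ?x0' ?y0' ?mulr0 ?addr0.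
move=> _ [[|j u] [s [r [w [Rr rs sn //= _ ->]]]]] /=.
have c0 : wcoef [::] (mon (j :: u) : T) = 0 by rewrite wcoef_mon.
have c1 x : wcoef [::] (mon (j :: u) * x) = 0 by rewrite wcoef_nilM c0 mul0r.
have c2 x : wcoef [::] (mon (j :: u) * x * mon w) = 0.
  by rewrite wcoef_nilM c1 mul0r.
by split; [exact: c2|exact: c2].
Qed.

(** The first letter belongs to the nonempty word [u], so cutting it acts in the same way on both
    coordinates. A syzygy among left multiples thus reduces to syzygies one degree lower. *)
Lemma syzL_cut n i z : GL n.+1 z -> GA n (lcut i z.1, lcut i z.2).
Proof.
move: z; apply: (@span_sub _ _ _ [set z : T * T | GA n (lcut i z.1, lcut i z.2)]).
  split=> [|a [x y] [x' y'] /= xy xy'].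
    by rewrite /= !linear0; exact: syz_p0.
  rewrite /= !lcut_is_linear; exact: ((sG _ _).2 a _ _ xy xy').
move=> _ [[|j u] [s [r [w [Rr rs sn //= _ ->]]]]] /=.
have c0 : wcoef [::] (mon (j :: u) : T) = 0 by rewrite wcoef_mon.
have c1 x : wcoef [::] (mon (j :: u) * x) = 0 by rewrite wcoef_nilM c0 mul0r.
have c2 x : wcoef [::] (mon (j :: u) * x * mon w) = 0.
  by rewrite wcoef_nilM c1 mul0r.
have cutE x : lcut i (mon (j :: u) * x * mon w) = (j == i)%:R *: (mon u * x * mon w).
  by rewrite (lcutM _ _ (c1 x)) (lcutM _ _ c0) lcut_mon -!scalerAl.
apply: (syz_eq (cutE _) (cutE _)).
have sn' : (size u + s + size w)%N = n by case: sn.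
exact: (subZ (sG _ n) _ (syz_gen (p:=fun _ _ => true) Rr rs sn' isT)).
Qed.

Lemma syzR_aug n z : GR n z -> wcoef [::] z.1 = 0 /\ wcoef [::] z.2 = 0.
Proof.
move: z; apply: (@span_sub _ _ _ [set z : T * T |
  wcoef [::] z.1 = 0 /\ wcoef [::] z.2 = 0]).
  split=> [|a [x y] [x' y'] [/= x0 y0] [/= x0' y0']]; first by rewrite /= !wcoef0.
  by split; rewrite /= ?wcoef_is_linear ?x0 ?y0 ?x0' ?y0' ?mulr0 ?addr0.
move=> _ [u [s [r [w [Rr rs sn w0 ->]]]]] /=.
case/lastP: w w0 sn => [//|w j] _ sn.
have c0 : wcoef [::] (mon (rcons w j) : T) = 0 by rewrite wcoef_mon; case: (w).
have c2 x : wcoef [::] (x * mon (rcons w j)) = 0 by rewrite wcoef_nilM c0 mulr0.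
by split; [exact: c2|exact: c2].
Qed.

Lemma syzR_cut n i z : GR n.+1 z -> GA n (rcut i z.1, rcut i z.2).
Proof.
move: z; apply: (@span_sub _ _ _ [set z : T * T | GA n (rcut i z.1, rcut i z.2)]).
  split=> [|a [x y] [x' y'] /= xy xy'].
    by rewrite /= !linear0; exact: syz_p0.
  rewrite /= !rcut_is_linear; exact: ((sG _ _).2 a _ _ xy xy').
move=> _ [u [s [r [w [Rr rs sn w0 ->]]]]] /=.
case/lastP: w w0 sn => [//|w j] _ sn.
have c0 : wcoef [::] (mon (rcons w j) : T) = 0 by rewrite wcoef_mon; case: (w).
have c2 x : wcoef [::] (x * mon (rcons w j)) = 0 by rewrite wcoef_nilM c0 mulr0.
have cutE x : rcut i (x * mon (rcons w j)) = (j == i)%:R *: (x * mon w).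
  by rewrite (rcutM _ _ c0) rcut_mon -!scalerAr.
apply: (syz_eq (cutE _) (cutE _)).
have sn' : (size u + s + size w)%N = n by move: sn; rewrite size_rcons addnS => -[].
exact: (subZ (sG _ n) _ (syz_gen (p:=fun _ _ => true) Rr rs sn' isT)).
Qed.

Lemma syz_le_deg n x : D n x -> tdeg_le n x.
Proof.
apply: span_sub; first exact: tdeg_le_subspace.
move=> _ [u [s [r [w [Rr rs sn ->]]]]]; apply: tdeg_leW sn _.
have un := @tdeg_mon _ _ u; have wn := @tdeg_mon _ _ w.
exact: tdeg_leM (tdeg_leM (tdegW un) (alpha_top Rr rs).1) (tdegW wn).
Qed.

Lemma mul_mon_ind (W : set T) a b y : subspace W ->
  (forall u w, wcoef u a != 0 -> wcoef w b != 0 -> W (mon u * y * mon w)) ->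
  W (a * y * b).
Proof.
move=> sW Wm; have Wb := subspace_mulr b sW.
apply: (mon_ind (subspace_mulr y Wb)) => u ua.
suff : W (mon u * y * b) by [].
apply: (mon_ind (subspace_mull (mon u * y) sW)) => w wb.
exact: Wm.
Qed.

Lemma mon_sandwich u u' w' w x :
  mon u * (mon u' * x * mon w') * mon w = mon (u ++ u') * x * mon (w' ++ w).
Proof. by rewrite -(monM u u') -(monM w' w); exact: mulr_sandwich. Qed.

(** Homogeneous generators of positive degree suffice because R is graded and zero in degree 0;
    [s.+1] is the form of the degree that [alpha_sub] expects. *)
Lemma ideal_ind (W : set T) : subspace W ->
  (forall u s r w, R r -> tdeg s.+1 r -> W (mon u * r * mon w)) ->
  ideal R `<=` W.
Proof.
move=> sW Wgen x.
pose X := span [set z | exists u s r w,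
  [/\ R r, tdeg s.+1 r & z = mon u * r * mon w]].
move=> Ix; suff : X x.
  move: x Ix => x _; apply: span_sub => // _ [u [s [r [w [Rr rs ->]]]]].
  exact: Wgen Rr rs.
move: x Ix; apply: smallest_sub.
  split; first exact: span_subspace.
  move=> a y b Xy; apply: (mul_mon_ind (span_subspace _)) => u w _ _.
  have sX : subspace X by exact: span_subspace.
  move: y Xy; apply: (span_sub (subspace_mull (mon u) (subspace_mulr (mon w) sX))).
  move=> _ [u' [s [r [w' [Rr rs ->]]]]]; apply: sub_span.
  exists (u ++ u'), s, r, (w' ++ w); split; [exact: Rr|exact: rs|].
  exact: mon_sandwich.
move=> r Rr; have [n rn] := exists_tdeg_le r.
rewrite (tdeg_le_sum rn); apply: (sub_sum (span_subspace _)) => -[[|i] il].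
  suff : X (hpart 0 r) by [].
  rewrite (Rlow0 (leq0n 1) (Rhom 0 Rr) (@tdeg_hpart _ _ 0 r)).
  exact: (sub0 (span_subspace _)).
apply: sub_span; exists [::], i, (hpart i.+1 r), [::].
by split; [exact: Rhom|exact: tdeg_hpart|rewrite mon_nil mul1r mulr1].
Qed.

Lemma syz_le_ideal x : ideal (alpha @` R) x -> exists n, D n x.
Proof.
move: x; apply: smallest_sub; last first.
  move=> _ [r Rr <-]; have [n rn] := exists_tdeg_le r; exists n.
  have m0 : tdeg_le 0 (1 : T) by rewrite -mon_nil; exact: tdegW (@tdeg_mon _ _ [::]).
  rewrite -[alpha r]mul1r -[1 * _]mulr1.
  by apply: (syz_le_prod Rr m0 rn m0); rewrite addn0.
have sE : subspace [set x | exists n, D n x].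
  split=> [|a x y [m Dm] [n Dn]]; first by exists 0%N; exact: (sub0 (sD 0)).
  exists (maxn m n); apply: (sD _).2; [apply: syz_leW Dm|apply: syz_leW Dn].
    exact: leq_maxl.
  exact: leq_maxr.
split=> // a y b [n Dn]; apply: (mul_mon_ind sE) => u w _ _.
exists (size u + n + size w)%N; exact: (@syz_leMr w _ _ (@syz_leMl u n y Dn)).
Qed.

Definition syz_trivial n := forall y, GA n.+1 (0, y) -> D n y.

Lemma jacobi_syz_trivial n : jacobi (alpha @` R) n -> syz_trivial n.
Proof.
move=> jac y Gy; have [/= _ yn y0] := syz_top Gy.
rewrite -jacobi_spaceE; apply: jac; split; last exact: tdeg_le_lt.
by rewrite jacobi_spaceE; exact: syz_D Gy.
Qed.

(** Start of the induction: a generator of total degree 1 involves an [r] of degree at most 1, hence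
    zero. *)
Lemma syz_trivial0 : syz_trivial 0.
Proof.
move=> y Gy; suff -> : y = 0 by exact: (sub0 (sD 0)).
suff : [set 0 : T * T] (0, y) by case.
move: Gy; apply: span_sub; first by split=> // a x x' -> ->; rewrite scaler0 addr0.
move=> _ [u [s [r [w [Rr rs sn _ ->]]]]].
have s1 : (s <= 1)%N by rewrite -sn -addnA addnCA leq_addr.
by rewrite (Rlow0 s1 Rr rs) alpha0 !mulr0 !mul0r.
Qed.

Lemma syz_trivialL n y : syz_trivial n -> GL n.+2 (0, y) -> D n.+1 y.
Proof.
move=> Hn Gy; have [_ /= y0] := syzL_aug Gy.
rewrite (sum_lcut y0); apply: (sub_sum (sD _)) => i.
apply: (@syz_leMl [:: i] n); apply: Hn.
by have := syzL_cut i Gy; rewrite /= linear0.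
Qed.

Lemma syz_trivialR n y : syz_trivial n -> GR n.+2 (0, y) -> D n.+1 y.
Proof.
move=> Hn Gy; have [_ /= y0] := syzR_aug Gy.
rewrite (sum_rcut y0); apply: (sub_sum (sD _)) => i.
rewrite -(addn1 n); apply: (@syz_leMr [:: i] n); apply: Hn.
by have := syzR_cut i Gy; rewrite /= linear0.
Qed.

(** An element of <Q> lies in Q_m for some m. As long as m exceeds its degree, its part of degree m
    is zero, so the lift given by [syz_le_lift] is a syzygy and m can be lowered. At m = n the
    generators of Q_n have their part of degree n in <R>. *)
Lemma ideal_top : (forall n, syz_trivial n) -> forall n x,
  ideal (alpha @` R) x -> tdeg_le n x -> ideal R (hpart n x).
Proof.
move=> H n x /syz_le_ideal[m Dm] xn.
have {m Dm} Dn : D n x.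
  have [mn|nm] := leqP m n; first exact: syz_leW Dm.
  have [k mE] : exists k, m = (n + k)%N by exists (m - n)%N; lia.
  move: Dm; rewrite {}mE; elim: k {nm} => [|k IH]; rewrite ?addn0 // addnS => Dk.
  apply: IH; have [z [y' [Gy Dy]]] := syz_le_lift Dk.
  have [_ /= _ zE] := syz_top Gy.
  have z0 : z = 0.
    have h1 : hpart (n + k).+1 x = 0 by apply: hpart_lt xn; rewrite ltnS leq_addr.
    have h2 := hpart_lt (ltnSn _) (syz_le_deg Dy).
    by rewrite -zE -[y'](subKr x) hpartB h1 h2 subr0.
  rewrite -[x](subrK y'); apply: (subD (sD _)) Dy _.
  by apply: H; rewrite -z0.
move: x Dn {xn}; have sI := (ideal_two_sided R).1.
apply: span_sub; first exact: subspace_preimage (hpart_is_linear n) sI.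
move=> _ [u [s [r [w [Rr rs sn ->]]]]].
suff : ideal R (hpart n (mon u * alpha r * mon w)) by [].
have Gz := syz_gen (p := fun _ _ => true) Rr rs (erefl _) isT : syz _ _ (mon u * r * mon w, _).
have [/= _ yd yE] := syz_top Gz.
move: sn; rewrite leq_eqVlt => /predU1P[<-|sn].
  by rewrite yE; apply: ideal_gen.
by rewrite (hpart_lt sn yd); exact: (sub0 sI).
Qed.

(** * The induction step: syzygies of the next degree when Tor_3 vanishes there *)

Section Step.
Variable I : set T.
Hypothesis idI : two_sided_ideal I.
Hypothesis lowI : forall x u, I x -> (size u <= 1)%N -> wcoef u x = 0.
Hypothesis IE : I = ideal R.
(** Minimality of R: as [x1] ranges over T_+ I and [x2] over I T_+, this says that R meets T_+ I + I
    T_+ only in 0. *)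
Hypothesis indecR : forall r x1 x2, R r -> wcoef [::] x1 = 0 -> wcoef [::] x2 = 0 ->
  (forall i, I (lcut i x1)) -> (forall i, I (rcut i x2)) -> r + x1 + x2 = 0 -> r = 0.

(** For such elements, exchanging a left lift for a right one costs only an element of Q_(n-1).
    Passing to [hpart n] makes this a subspace of all of T, so that it can be tested on generators
    of any degree. *)
Definition liftable n : set T := [set x | exists y y',
  [/\ GL n (hpart n x, y), GR n (hpart n x, y') & D n.-1 (y - y')]].

Lemma liftable_subspace n : subspace (liftable n).
Proof.
split=> [|a x1 x2 [y1 [y1' [G1 G1' D1]]] [y2 [y2' [G2 G2' D2]]]].
  exists 0, 0; rewrite hpart0 subrr; split; try exact: syz_p0.
  exact: (sub0 (sD _)).
exists (a *: y1 + y2), (a *: y1' + y2'); rewrite hpart_is_linear; split.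
- exact: ((sG _ _).2 a _ _ G1 G2).
- exact: ((sG _ _).2 a _ _ G1' G2').
have -> : a *: y1 + y2 - (a *: y1' + y2') = a *: (y1 - y1') + (y2 - y2').
  by rewrite opprD addrACA scalerBr.
exact: ((sD _).2 a _ _ D1 D2).
Qed.

Lemma liftable_mid n u s r w : u != [::] -> w != [::] -> R r -> tdeg s r ->
  liftable n (mon u * r * mon w).
Proof.
move=> u0 w0 Rr rs.
have xd : tdeg (size u + s + size w) (mon u * r * mon w).
  exact: tdegM (tdegM (@tdeg_mon _ _ u) rs) (@tdeg_mon _ _ w).
have [n'|nn] := eqVneq (size u + s + size w)%N n.
  exists (mon u * alpha r * mon w), (mon u * alpha r * mon w).
  rewrite (hpart_tdeg n xd) n' eqxx subrr; split.
  - exact: syz_gen Rr rs n' u0.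
  - exact: syz_gen Rr rs n' w0.
  exact: (sub0 (sD _)).
exists 0, 0; rewrite (hpart_tdeg n xd) (negPf nn) subrr.
by split; [exact: syz_p0|exact: syz_p0|exact: (sub0 (sD _))].
Qed.

Lemma syzL_gen n i a s r w : R r -> tdeg s r -> tdeg i.+1 a ->
  (i.+1 + s + size w)%N = n -> GL n (a * r * mon w, a * alpha r * mon w).
Proof.
move=> Rr rs ai nE.
pose f a : T * T := (a * r * mon w, a * alpha r * mon w).
have fl : linear f by exact: pair_mull_linear.
apply: (tdeg_ind (subspace_preimage fl (sG _ n)) _ ai) => u us.
apply: syz_gen Rr rs _ _; first by rewrite us.
by rewrite -size_eq0 us.
Qed.

Lemma syzR_gen n i b s r u : R r -> tdeg s r -> tdeg i.+1 b ->
  (size u + s + i.+1)%N = n -> GR n (mon u * r * b, mon u * alpha r * b).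
Proof.
move=> Rr rs bi nE.
pose f b : T * T := (mon u * r * b, mon u * alpha r * b).
have fl : linear f by exact: pair_mulr_linear.
apply: (tdeg_ind (subspace_preimage fl (sG _ n)) _ bi) => w ws.
apply: syz_gen Rr rs _ _; first by rewrite ws.
by rewrite -size_eq0 ws.
Qed.

(* The two lifts of u r v r' w evaluate alpha on r' and on r respectively; their
   difference is u (alpha r) v (alpha r' - r') w - u (alpha r - r) v (alpha r') w. *)
Lemma liftable_sq n u s r v s' r' w : R r -> tdeg s.+1 r -> R r' -> tdeg s'.+1 r' ->
  liftable n (mon u * r * mon v * r' * mon w).
Proof.
move=> Rr rs Rr' rs'.
have ud := @tdeg_mon _ _ u; have wd := @tdeg_mon _ _ w; have vd := @tdeg_mon _ _ v.
have ad := tdegM (tdegM ud rs) vd; have bd := tdegM (tdegM vd rs') wd.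
have xd := tdegM (tdegM ad rs') wd.
set m := (size u + s.+1 + size v + s'.+1 + size w)%N in xd.
have [n'|nn] := eqVneq m n; last first.
  exists 0, 0; rewrite (hpart_tdeg n xd) (negPf nn) subrr.
  by split; [exact: syz_p0|exact: syz_p0|exact: (sub0 (sD _))].
exists (mon u * r * mon v * alpha r' * mon w), (mon u * alpha r * (mon v * r' * mon w)).
rewrite (hpart_tdeg n xd) n' eqxx.
have aE : (size u + s.+1 + size v)%N = (size u + s + size v).+1 by rewrite addnS addSn.
have bE : (size v + s'.+1 + size w)%N = (size v + s' + size w).+1 by rewrite addnS addSn.
rewrite aE in ad; rewrite bE in bd; split.
- by apply: (syzL_gen Rr' rs' ad); rewrite -aE.
- have e : mon u * r * mon v * r' * mon w = mon u * r * (mon v * r' * mon w).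
    exact: mulr_split.
  apply: (syz_eq e (erefl _)); apply: (syzR_gen Rr rs bd).
  by rewrite -bE -n' /m; lia.
apply: (eq_ind_r (D n.-1) _ (liftable_aux _ _ _ _ _ _ _)).
have u' := tdegW ud; have v' := tdegW vd; have w' := tdegW wd.
have r1 := alpha_sub Rr rs; have r1' := alpha_sub Rr' rs'.
apply: (subB (sD _)).
  apply: (syz_le_prod Rr u' (tdegW rs) (tdeg_leM (tdeg_leM v' r1') w')).
  by rewrite -n' /m; lia.
apply: (syz_le_prod Rr' (tdeg_leM (tdeg_leM u' r1) v') (tdegW rs') w').
by rewrite -n' /m; lia.
Qed.

Lemma decomposable3_liftable n : decomposable3 I `<=` liftable n.
Proof.
have sL := liftable_subspace n.
apply: span_sub => // x [[a [b [y [a0 b0]]]]|[y [y' []]]]; rewrite IE.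
  move=> Iy ->; apply: (mul_mon_ind sL) => u w ua wb.
  have u0 : u != [::] by apply: contraNneq ua => ->; rewrite a0.
  have w0 : w != [::] by apply: contraNneq wb => ->; rewrite b0.
  move: y Iy; apply: (ideal_ind (subspace_mull (mon u) (subspace_mulr (mon w) sL))).
  move=> u' s r w' Rr rs.
  suff : liftable n (mon u * (mon u' * r * mon w') * mon w) by [].
  rewrite mon_sandwich.
  by apply: liftable_mid rs => //; [case: (u) u0|case: (w') => //; case: (w) w0].
move=> Iy Iy' ->; move: y Iy.
apply: (ideal_ind (subspace_mulr y' sL)) => u s r v Rr rs.
move: y' Iy'.
apply: (ideal_ind (subspace_mull (mon u * r * mon v) sL)) => v' s' r' w Rr' rs'.
suff : liftable n (mon u * r * mon v * (mon v' * r' * mon w)) by [].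
have -> : mon u * r * mon v * (mon v' * r' * mon w) =
    mon u * r * mon (v ++ v') * r' * mon w by rewrite -(monM v v'); exact: mulr_join.
exact: liftable_sq Rr rs Rr' rs'.
Qed.

(** Minimality of R removes the component in R of a syzygy. What remains is x1 + x2 = 0 with x1 in
    T_+ I and x2 in I T_+, so x1 lies in both, and the vanishing of Tor makes it [liftable]. *)
Lemma syz_trivial_step n :
  Tor (alg_deg I) 3 n.+2 = [set 0] -> syz_trivial n -> syz_trivial n.+1.
Proof.
move=> tor0 Hn y /syz_split[r [[x1 y1] [[x2 y2] [Rr G1 G2 E]]]].
have xE : 0 = r + x1 + x2 := congr1 fst E.
have -> : y = alpha r + y1 + y2 := congr1 snd E.
have [/= x10 _] := syzL_aug G1; have [/= x20 _] := syzR_aug G2.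
have l1 i : I (lcut i x1) by rewrite IE; exact: syz_ideal (syzL_cut i G1).
have r2 i : I (rcut i x2) by rewrite IE; exact: syz_ideal (syzR_cut i G2).
have r0 := indecR Rr x10 x20 l1 r2 (esym xE).
rewrite r0 alpha0 add0r; move: xE; rewrite r0 add0r => xE.
have x1E : x1 = - x2 by apply/eqP; rewrite -addr_eq0 -xE.
have r1 i : I (rcut i x1) by rewrite x1E linearN /=; exact: (subN idI.1 (r2 i)).
have [/= x1d _ _] := syz_top G1.
have Jx := decomposable3_of_Tor3 idI lowI (ltn0Sn _) tor0 x1d l1 r1.
have [y' [y'' []]] := decomposable3_liftable n.+2 Jx.
rewrite (hpart_ident x1d) => G1' G2' Dy.
(* [y1] and [y'] come from two left lifts of x1, [- y2] and [y''] from two right lifts of x1 = - x2.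
   The differences come from one-sided syzygies, which reduce to [Hn]. *)
have D1 : D n.+1 (y1 - y').
  by apply: (syz_trivialL Hn); rewrite -(subrr x1); exact: syz_pB G1 G1'.
have D2 : D n.+1 (y2 + y'').
  apply: (syz_trivialR Hn); have -> : 0 = x2 + x1 by rewrite addrC.
  exact: syz_pD G2 G2'.
have -> : y1 + y2 = (y1 - y') + (y2 + y'') + (y' - y'').
  by rewrite (addrACA y1) -[RHS]addrA [- y' + _]addrC -[y'' - y']opprB addNr addr0.
by apply: (subD (sD _)) => //; apply: (subD (sD _)).
Qed.

End Step.

End Syzygies.

(** * PBW-deformations *)

Lemma quotient_lift (K : fieldType) (E F : lmodType K) (X : set E) (f : E -> F) :
  linear f -> (forall x, X x -> f x = 0) ->
  exists phi : {linear quotient X -> F}, forall x, phi (qproj X x) = f x.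
Proof.
move=> fl fX.
have f0 x : span X x -> f x = 0.
  apply: (@span_sub _ _ X [set x | f x = 0]) => //.
  apply: (subspace_preimage fl (W := [set 0])).
  by split=> // a y z -> ->; rewrite scaler0 addr0.
have fE x : f (qrepr X (qproj X x)) = f x.
  have := f0 _ (qprojK (X:=X) x); rewrite addrC -scaleN1r fl scaleN1r => /eqP.
  by rewrite addrC subr_eq0 => /eqP.
pose phi u := f (qrepr X u).
have phiL : linear phi.
  move=> a; apply: qproj_ind => x; apply: qproj_ind => y.
  by rewrite -linearZ -linearD /phi /= !fE fl.
pose L := GRing.isLinear.Build K (quotient X) F *:%R phi phiL.
pose g : {linear quotient X -> F} := HB.pack phi L.
by exists g => x; apply: fE.
Qed.

Section PBW.
Context {K : fieldType} {V : vectType K}.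
Local Notation T := (tensor_alg V).
Implicit Types (R P : set T).

Lemma subspace_image (E F : lmodType K) (f : E -> F) (W : set E) :
  linear f -> subspace W -> subspace (f @` W).
Proof.
move=> fl sW; split=> [|a _ _ [x Wx <-] [y Wy <-]].
  exists 0; first exact: sub0.
  exact: linear_at0 fl.
by exists (a *: x + y); [exact: sW.2|exact: fl].
Qed.

Lemma aproj_linear (X : set T) : linear (aproj X).
Proof. by move=> a x y; rewrite linearP. Qed.

Lemma aproj_eq0 (X : set T) x : aproj X x = 0 <-> ideal X x.
Proof.
have -> : ideal X x = ideal X (x - 0) by rewrite subr0.
by rewrite -aprojP linear0.
Qed.

Lemma ufilt_pred_subspace P n : subspace (ufilt_pred P n).
Proof.
case: n => [|n] /=; first by split=> // a x y -> ->; rewrite scaler0 addr0.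
exact: subspace_image (aproj_linear P) (tdeg_le_subspace n).
Qed.

Lemma gr_proj_eq P n x y :
  qproj (ufilt_pred P n) (aproj P x) = qproj (ufilt_pred P n) (aproj P y) <->
  ufilt_pred P n (aproj P (x - y)).
Proof.
by rewrite qprojP (span_id (ufilt_pred_subspace P n)) -linearB.
Qed.

Lemma gr_proj_eq0 P n x :
  qproj (ufilt_pred P n) (aproj P x) = 0 <-> ufilt_pred P n (aproj P x).
Proof.
rewrite -[X in _ = X](linear0 (qproj (ufilt_pred P n))) qprojP.
by rewrite (span_id (ufilt_pred_subspace P n)) subr0.
Qed.

(** Together with [ufilt_pred_hpart], this turns the vanishing of a class in gr^n into a statement
    about parts of degree n of elements of <P>. For n = 0 the preceding step of the filtration is
    zero, hence the case distinctions. *)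
Lemma ufilt_predP P n x : tdeg_le n x -> ufilt_pred P n (aproj P x) ->
  exists y, [/\ ideal P y, tdeg_le n y & hpart n y = hpart n x].
Proof.
case: n => [|n] xn /=; first by move/aproj_eq0 => Px; exists x.
move=> [y yn /aprojP yx]; exists (x - y); split.
- rewrite -opprB; exact: (subN (ideal_two_sided P).1).
- exact: (subB (tdeg_le_subspace _) xn (tdeg_leW (leqnSn n) yn)).
by rewrite hpartB (hpart_lt (ltnSn n) yn) subr0.
Qed.

Lemma ufilt_pred_hpart P n x y : ideal P y -> tdeg_le n y ->
  tdeg_le n x -> hpart n y = hpart n x -> ufilt_pred P n (aproj P x).
Proof.
case: n => [|n] Py yn xn yx /=.
  apply/aproj_eq0; suff -> : x = y by [].
  by rewrite -(hpart0_le xn) -(hpart0_le yn).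
exists (x - y); last by apply/aprojP; rewrite addrAC subrr sub0r;
  exact: (subN (ideal_two_sided P).1).
apply: tdeg_le_lt; first exact: (subB (tdeg_le_subspace _) xn yn).
by rewrite hpartB yx subrr.
Qed.

(** As [x] is zero in U(P), its part of degree n is congruent to terms of lower degree and dies in
    gr^n; injectivity of the canonical map puts it into <R>. *)
Lemma pbw_top R P : pbw_deformation R P -> forall n x,
  ideal P x -> tdeg_le n x -> ideal R (hpart n x).
Proof.
move=> pbw n x Px xn; have [phi [phiE [_ phi_inj _]]] := pbw n.
apply/aproj_eq0; apply: phi_inj.
- by apply: mem_set; exists (hpart n x) => //; apply: tdeg_hpart.
- by apply: mem_set; exists 0; [exact: (sub0 (tdeg_subspace n))|rewrite linear0].
rewrite (phiE _ (@tdeg_hpart _ _ n x)) linear0.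
apply/gr_proj_eq0; apply: (ufilt_pred_hpart Px xn).
  exact: tdegW (@tdeg_hpart _ _ n x).
by rewrite (hpart_ident (@tdeg_hpart _ _ n x)).
Qed.

(** The first condition gives injectivity, the second that the canonical map is well defined.
    Surjectivity is automatic: an element of degree at most n equals its part of degree n modulo the
    preceding step of the filtration. *)
Lemma pbw_of_top R P :
  (forall n x, ideal P x -> tdeg_le n x -> ideal R (hpart n x)) ->
  (forall n x, ideal R x ->
     exists y, [/\ ideal P y, tdeg_le n y & hpart n y = hpart n x]) ->
  pbw_deformation R P.
Proof.
move=> PR RP n.
(* Composing with [hpart n] extends the map from T^n to all of T, where [quotient_lift] applies. *)
pose f x : quotient (ufilt_pred P n) := qproj _ (aproj P (hpart n x)).
have fl : linear f by move=> a x y; rewrite /f hpart_is_linear !linearP.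
have [phi phiE] : exists phi : {linear quotient_alg R -> quotient (ufilt_pred P n)},
    forall x, phi (aproj R x) = f x.
  apply: (@quotient_lift _ _ _ (ideal R) f fl) => x Rx.
  apply/gr_proj_eq0; have [y [Py yn yx]] := RP n x Rx.
  have hd := @tdeg_hpart _ _ n x.
  by apply: (ufilt_pred_hpart Py yn (tdegW hd)); rewrite (hpart_ident hd).
exists phi; split=> [x xn|]; first by rewrite phiE /f (hpart_ident xn).
split.
- move=> _ [x xn <-]; rewrite phiE /f (hpart_ident xn).
  by exists (aproj P x) => //; exists x => //; apply: tdegW.
- move=> u v /set_mem[x xn <-] /set_mem[y yn <-].
  rewrite !phiE /f (hpart_ident xn) (hpart_ident yn) => /gr_proj_eq.
  have xyn := subB (tdeg_subspace n) xn yn.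
  move=> /(ufilt_predP (tdegW xyn))[z [Pz zn zE]].
  by apply/aprojP; rewrite -(hpart_ident xyn) -zE; apply: PR.
move=> _ [_ [x xn <-] <-]; exists (aproj R (hpart n x)).
  by exists (hpart n x) => //; apply: tdeg_hpart.
rewrite phiE /f (hpart_ident (@tdeg_hpart _ _ n x)); apply/gr_proj_eq.
case: n xn {f fl phi phiE} => [|n] xn /=.
  by rewrite (hpart0_le xn) subrr linear0.
exists (hpart n.+1 x - x) => //; rewrite -opprB.
exact: (subN (tdeg_le_subspace n) (tdeg_leB xn)).
Qed.

End PBW.

(** * Spaces of relations *)

Section Relations.
Context {K : fieldType} {V : vectType K}.
Local Notation T := (tensor_alg V).
Local Notation d := (\dim {:V}).
Variables (I R : set T) (S : {fset nat}).
Hypothesis rel : space_of_relations I R S.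
Let idI := rel_ideal rel.
Let sI : subspace I := idI.1.
Let sR := rel_subspace rel.
Local Notation tV := (range (@tincl K V)).

Lemma relations_hpart n x : R x -> R (hpart n x).
Proof.
rewrite [X in X x](rel_degrees rel); move: x; apply: span_sub.
  exact: subspace_preimage (@hpart_is_linear _ _ n) sR.
move=> x [s _ [Rx xs]]; suff : R (hpart n x) by [].
rewrite (hpart_tdeg n xs); case: ifP => _; [exact: Rx|exact: (sub0 sR)].
Qed.

Lemma relations_low r (u : seq 'I_d) : R r -> (size u <= 1)%N -> wcoef u r = 0.
Proof.
rewrite [X in X r](rel_degrees rel) => Rr u1.
move: r Rr; apply: (@span_sub _ _ _ [set r | wcoef u r = 0]).
  split=> [|a x y /= x0 y0]; first exact: wcoef0.
  by rewrite wcoef_is_linear x0 y0 mulr0 addr0.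
move=> x [s /= sS [Rx /tdegP xs]]; apply: xs.
have s2 := rel_degree_ge2 rel sS; by apply/eqP => us; move: u1; rewrite us leqNgt s2.
Qed.

Lemma ideal_decomp x : I x -> exists r p q,
  [/\ R r, prod_of tV I p, prod_of I tV q & x = r + (p + q)].
Proof.
have [E _] := rel_direct_sum rel; move=> Ix.
have : sum_of R (sum_of (prod_of tV I) (prod_of I tV)) x by rewrite -E.
by move=> [r [_ [Rr [p [q [Vp Vq ->]]] ->]]]; exists r, p, q.
Qed.

Lemma relations_sub : R `<=` I.
Proof.
have [E _] := rel_direct_sum rel => r Rr.
suff : sum_of R (sum_of (prod_of tV I) (prod_of I tV)) r by rewrite -E.
exists r, 0; split=> //; last by rewrite addr0.
by exists 0, 0; split; rewrite ?addr0 //; exact: (sub0 (span_subspace _)).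
Qed.

Lemma wcoef_nil_tincl v : wcoef [::] (tincl v : T) = 0.
Proof. by have /tdegP := @tdeg_tincl _ _ v; apply. Qed.

(** Constant terms are excluded by I = R + (V I + I V), since R starts in degree 2; degree 1 is
    excluded because I is homogeneous and meets V in 0. *)
Lemma ideal_low x (u : seq 'I_d) : I x -> (size u <= 1)%N -> wcoef u x = 0.
Proof.
have nil0 y : I y -> wcoef [::] y = 0.
  have s0 : subspace [set y : T | wcoef [::] y = 0].
    split=> [|a x' y' /= x0 y0]; first exact: wcoef0.
    by rewrite wcoef_is_linear x0 y0 mulr0 addr0.
  move=> /ideal_decomp[r [p [q [Rr Vp Vq ->]]]].
  apply: (subD s0); first exact: relations_low.
  apply: (subD s0).
    move: p Vp; apply: (span_sub s0) => _ [_ [z [[v _ <-] _ ->]]].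
    by rewrite /= wcoef_nilM wcoef_nil_tincl mul0r.
  move: q Vq; apply: (span_sub s0) => _ [z [_ [_ [v _ <-] ->]]].
  by rewrite /= wcoef_nilM wcoef_nil_tincl mulr0.
move=> Ix; case: u => [|i [|//]] _; first exact: nil0.
have Ix1 : I (hpart 1 x) by rewrite -tprojE; apply: (rel_ideal_homogeneous rel).
have [v vE] := tdeg1_tincl (@tdeg_hpart _ _ 1 x).
have v0 : v = 0 by apply: (rel_degree1 rel); rewrite -vE.
have := wcoef_hpart 1 [:: i] x; rewrite /= => <-.
by rewrite vE v0 /tincl big1 ?wcoef0 // => j _; rewrite linear0 scale0r.
Qed.

Lemma hpart_mull m n (a x : T) : tdeg m a -> hpart (m + n) (a * x) = a * hpart n x.
Proof.
move=> am; apply: (@linear_mon_eq _ _ _ (fun x => hpart (m + n) (a * x))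
  (fun x => a * hpart n x)).
- by move=> c y z; rewrite mulrDr -scalerAr hpart_is_linear.
- by move=> c y z; rewrite hpart_is_linear mulrDr -scalerAr.
move=> s _; rewrite (hpart_tdeg _ (tdegM am (@tdeg_mon _ _ s))).
rewrite (hpart_tdeg n (@tdeg_mon _ _ s)) eqn_add2l.
by case: ifP => // _; rewrite mulr0.
Qed.

Lemma hpart_mulr m n (a x : T) : tdeg m a -> hpart (n + m) (x * a) = hpart n x * a.
Proof.
move=> am; apply: (@linear_mon_eq _ _ _ (fun x => hpart (n + m) (x * a))
  (fun x => hpart n x * a)).
- by move=> c y z; rewrite mulrDl -scalerAl hpart_is_linear.
- by move=> c y z; rewrite hpart_is_linear mulrDl -scalerAl.
move=> s _; rewrite (hpart_tdeg _ (tdegM (@tdeg_mon _ _ s) am)).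
rewrite (hpart_tdeg n (@tdeg_mon _ _ s)) eqn_add2r.
by case: ifP => // _; rewrite mul0r.
Qed.

(** Graded Nakayama: the part of degree n + 1 of V I + I V involves only parts of degree n of
    elements of I. *)
Lemma relations_generate : I = ideal R.
Proof.
apply/seteqP; split; last by apply: smallest_sub => //; exact: relations_sub.
have sJ := (ideal_two_sided R).1.
have step n x : I x -> ideal R (hpart n x).
  elim: n x => [|n IH] x Ix.
    have -> : hpart 0 x = 0.
      apply: wcoefP => s; rewrite wcoef_hpart wcoef0; case: eqP => // s0.
      by apply: ideal_low => //; rewrite s0.
    exact: (sub0 sJ).
  have [r [p [q [Rr Vp Vq ->]]]] := ideal_decomp Ix.
  have sW := subspace_preimage (@hpart_is_linear _ _ n.+1) sJ.
  rewrite !hpartD; apply: (subD sJ).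
    by apply: sub_gen_smallest; exact: relations_hpart.
  apply: (subD sJ).
    move: p Vp; apply: (span_sub sW) => _ [_ [z [[v _ <-] Iz ->]]].
    suff : ideal R (hpart (1 + n) (tincl v * z)) by [].
    by rewrite (hpart_mull n z (@tdeg_tincl _ _ v)); apply: idealMl; exact: IH.
  move: q Vq; apply: (span_sub sW) => _ [z [_ [Iz [v _ <-] ->]]].
  suff : ideal R (hpart (n + 1) (z * tincl v)) by rewrite addn1.
  by rewrite (hpart_mulr n z (@tdeg_tincl _ _ v)); apply: idealMr; exact: IH.
move=> x Ix; have [n xn] := exists_tdeg_le x.
by rewrite (tdeg_le_sum xn); apply: (sub_sum sJ) => i; exact: step.
Qed.

Lemma relations_indecomposable r x1 x2 : R r ->
  wcoef [::] x1 = 0 -> wcoef [::] x2 = 0 ->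
  (forall i, I (lcut i x1)) -> (forall i, I (rcut i x2)) ->
  r + x1 + x2 = 0 -> r = 0.
Proof.
move=> Rr x10 x20 l1 r2 E; have [_ XY] := rel_direct_sum rel.
suff : (R `&` sum_of (prod_of tV I) (prod_of I tV)) r by rewrite XY.
split=> //; exists (- x1), (- x2).
have rE : r = - x1 - x2.
  by apply/eqP; rewrite -opprD -addr_eq0 addrA E.
have V1 : prod_of tV I x1.
  rewrite (sum_lcut x10); apply: (sub_sum (span_subspace _)) => i.
  apply: sub_span; exists (letter i), (lcut i x1).
  split; [|exact: l1|exact: erefl].
  by exists (vbasis {:V})`_i => //; exact: tincl_basis.
have V2 : prod_of I tV x2.
  rewrite (sum_rcut x20); apply: (sub_sum (span_subspace _)) => i.
  apply: sub_span; exists (rcut i x2), (letter i).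
  split; [exact: r2| |exact: erefl].
  by exists (vbasis {:V})`_i => //; exact: tincl_basis.
split; [exact: (subN (span_subspace _) V1)|exact: (subN (span_subspace _) V2)|exact: rE].
Qed.

Lemma Tor_contains0 n : Tor (alg_deg I) 3 n 0.
Proof.
exists 0; last exact: linear0.
split; first exact: (sub0 (span_subspace _)).
by rewrite bar_diffE linear0; exact: (sub0 (span_subspace _)).
Qed.

(** For i = 3 the summand of [s] sits in the single degree n_s(3) = s + 1. *)
Lemma multi_koszul_Tor3 n : multi_koszul I R S ->
  (forall s, s \in S -> s.+1 != n) -> Tor (alg_deg I) 3 n = [set 0].
Proof.
move=> /(_ 3 isT n)[phi [phi_fun phi_inj _]] nS.
have K0 g : koszul_sum R S 3 n g -> g = 0.
  move=> gK; apply/ffunP => s; rewrite ffunE; move: (gK s).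
  by rewrite /tor_deg /= muln1 (negPf (nS _ (fsvalP s))).
apply/seteqP; split=> [u Tu|_ ->]; last exact: Tor_contains0.
apply: phi_inj; [exact: mem_set|exact/mem_set/Tor_contains0|].
by rewrite linear0; apply: K0; exact: phi_fun.
Qed.

Lemma Tor3_degree0 : Tor (alg_deg I) 3 0 = [set 0].
Proof.
apply/seteqP; split=> [u [z [zc _] <-]|_ ->]; last exact: Tor_contains0.
suff -> : z = 0 by rewrite linear0.
move: z zc; apply: (@span_sub _ _ _ [set 0 : bar I 3]).
  by split=> // a x y -> ->; rewrite scaler0 addr0.
move=> x [m [t [mt m0 _]]]; exfalso; have := (mt ord0).1.
have /eqP := m0; rewrite big_ord_recl addn_eq0 => /andP[/eqP e _].
by rewrite e.
Qed.

(** The value -1 cannot arise as a supremum: a nonzero Tor_(3,m) has m > 0 and contributes m - 1 >=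
    0. *)
Lemma c_inv_Tor3 n : c_inv (alg_deg I) = (-1)%:E -> Tor (alg_deg I) 3 n = [set 0].
Proof.
rewrite /c_inv; case: asboolP => [T0 _|nT]; first exact: T0.
set A := [set _ | _ in _]; rewrite /supremum; case: ifP => // A0.
case: xgetP => // y _ [ubA _] yE.
exfalso; apply: nT => m; apply: contrapT => Tm.
have := ubA (m%:Z - 1)%:E (ex_intro2 _ _ m Tm (erefl _)); rewrite yE lee_fin.
case: m Tm => [|m] Tm; first by case: Tm; exact: Tor3_degree0.
by lia.
Qed.

End Relations.

(** * Choosing a filtered morphism with values in P *)

Section FilteredMorphism.
Context {K : fieldType} {V : vectType K}.
Local Notation T := (tensor_alg V).

(** In each degree [linear_selection] picks, linearly in r, an element of P with top part r. Finite
    dimension bounds the degrees of R, so the choices add up to one finite sum. *)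
Lemma exists_filtered_morphism (R P : set T) : subspace R ->
  (forall n x, R x -> R (hpart n x)) -> finite_dimensional R ->
  subspace P -> R `<=` top_parts P ->
  exists alpha, filtered_morphism R alpha /\ alpha @` R `<=` P.
Proof.
move=> sR Rhom Rfin sP RP.
pose G n : T -> set T := fun x => [set y | [/\ P y, tdeg_le n y & hpart n y = x]].
have GL n a x y u v : G n x u -> G n y v -> G n (a *: x + y) (a *: u + v).
  move=> [Pu un <-] [Pv vn <-]; split; first exact: sP.2.
    exact: (tdeg_le_subspace n).2.
  exact: hpart_is_linear.
have topE n x : top_parts P x -> exists y, G n (hpart n x) y.
  move: x; apply: (@span_sub _ _ _ [set x | exists y, G n (hpart n x) y]).
    split=> [|a x y [u Gu] [v Gv]].
      exists 0; split; [exact: (sub0 sP)|exact: (sub0 (tdeg_le_subspace n))|].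
      by rewrite !hpart0.
    by exists (a *: u + v); rewrite hpart_is_linear; exact: GL.
  move=> _ [m _ [y [Py ym] <-]]; rewrite /= tprojE.
  have hm := @tdeg_hpart _ _ m y.
  rewrite (hpart_tdeg n hm); case: eqP => [mn|_].
    by exists y; rewrite -mn; split.
  exists 0; split; [exact: (sub0 sP)|exact: (sub0 (tdeg_le_subspace n))|].
  exact: hpart0.
have sel n : {f : T -> T | (forall x, (R `&` tdeg n) x -> G n x (f x)) /\
    forall a x y, (R `&` tdeg n) x -> (R `&` tdeg n) y ->
      f (a *: x + y) = a *: f x + f y}.
  apply: cid; apply: linear_selection (GL n).
    exact: subspaceI sR (tdeg_subspace n).
  by move=> x [/RP /(topE n)[y Gy] xn]; exists y; rewrite -(hpart_ident xn).
pose f n := sval (sel n).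
have fG n x : R x -> tdeg n x -> G n x (f n x).
  by move=> Rx xn; apply: (svalP (sel n)).1.
have fL n a x y : R x -> R y ->
    f n (hpart n (a *: x + y)) = a *: f n (hpart n x) + f n (hpart n y).
  move=> Rx Ry; rewrite hpart_is_linear.
  by apply: (svalP (sel n)).2; split; try exact: Rhom; exact: tdeg_hpart.
have f0 n : f n 0 = 0.
  have := fL n (-1) 0 0 (sub0 sR) (sub0 sR).
  by rewrite scaler0 addr0 hpart0 scaleN1r addNr.
have [N RN] : exists N, forall x, R x -> tdeg_le N x.
  have [s ->] := Rfin.
  have [N sN] : exists N, forall x, x \in s -> tdeg_le N x.
    elim: s => [|x s [N IH]]; first by exists 0%N.
    have [m xm] := exists_tdeg_le x; exists (maxn m N) => y.
    rewrite inE => /predU1P[->|ys].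
      exact: tdeg_leW (leq_maxl _ _) xm.
    exact: tdeg_leW (leq_maxr _ _) (IH y ys).
  by exists N; apply: span_sub => //; exact: tdeg_le_subspace.
exists (fun x => \sum_(n < N.+1) f n (hpart n x)); split; first split.
- move=> a x y Rx Ry; rewrite scaler_sumr -big_split; apply: eq_bigr => n _.
  exact: fL.
- move=> n r Rr rn.
  have -> : \sum_(i < N.+1) f i (hpart i r) = f n r.
    have fz i : n != i -> f i (hpart i r) = 0.
      by move=> /negPf ni; rewrite (hpart_tdeg i rn) ni f0.
    have [nN|Nn] := ltnP n N.+1; last first.
      have r0 : r = 0.
        by rewrite -(hpart_ident rn) (hpart_lt _ (RN r Rr)).
      by rewrite r0 f0 big1 // => i _; rewrite hpart0 f0.
    rewrite (bigD1 (Ordinal nN)) //= big1 => [|i ni]; last first.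
      by apply: fz; apply: contra ni => /eqP ni; apply/eqP/val_inj.
    by rewrite addr0 (hpart_ident rn).
  by rewrite tprojE; have [] := fG n r Rr rn.
move=> _ [x Rx <-]; apply: (sub_sum sP) => n.
by have [] := fG n _ (Rhom n _ Rx) (@tdeg_hpart _ _ n x).
Qed.

End FilteredMorphism.

(** * Comparing top parts in <P>, <alpha(R)> and <R> *)

Section TopDegreeParts.
Context {K : fieldType} {V : vectType K}.
Local Notation T := (tensor_alg V).
Variables (R P : set T) (alpha : T -> T).
Hypothesis sR : subspace R.
Hypothesis Rhom : forall n x, R x -> R (hpart n x).
Hypothesis Rlow : forall r (u : seq 'I_(\dim {:V})),
  R r -> (size u <= 1)%N -> wcoef u r = 0.
Hypothesis alphaL : forall (a : K) x y, R x -> R y ->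
  alpha (a *: x + y) = a *: alpha x + alpha y.
Hypothesis alpha_top : forall n r, R r -> tdeg n r ->
  tdeg_le n (alpha r) /\ hpart n (alpha r) = r.
Hypothesis alphaP : alpha @` R `<=` P.

(** A generator u r w of <R> lifts to u (alpha r) w, which has the same top part. *)
Lemma ideal_lift n x : ideal R x ->
  exists y, [/\ ideal P y, tdeg_le n y & hpart n y = hpart n x].
Proof.
have sI := (ideal_two_sided P).1.
have z0 : [/\ ideal P 0, tdeg_le n (0 : T) & hpart n (0 : T) = 0].
  by split; [exact: (sub0 sI)|exact: (sub0 (tdeg_le_subspace n))|exact: hpart0].
move: x; apply: (@ideal_ind _ _ R Rhom Rlow [set x |
    exists y, [/\ ideal P y, tdeg_le n y & hpart n y = hpart n x]]).
  split=> [|a x x' [y [Py yn yx]] [y' [Py' yn' yx']]].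
    by exists 0; case: z0 => Pz nz _; split; [exact: Pz|exact: nz|].
  exists (a *: y + y'); split; first exact: sI.2.
    exact: (tdeg_le_subspace n).2.
  by rewrite !hpart_is_linear yx yx'.
move=> u s r w Rr rs; rewrite /=.
have Gz := @syz_gen _ _ R alpha (fun _ _ => true) _ u s.+1 r w Rr rs (erefl _) isT.
have [/= xd yd yE] := syz_top sR Rlow alphaL alpha_top Gz.
have [mn|/negPf mn] := eqVneq (size u + s.+1 + size w)%N n; last first.
  by exists 0; rewrite (hpart_tdeg n xd) mn; exact: z0.
rewrite mn in xd yd yE; exists (mon u * alpha r * mon w); split; [|exact: yd|].
  apply: (ideal_two_sided P).2; apply: sub_gen_smallest; apply: alphaP.
  by exists r.
exact: (etrans yE (esym (hpart_ident xd))).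
Qed.

(** Both conclusions follow from [PD]. The part of degree n of an element of <P> of degree at most n
    lies in <R>, hence is shared with an element of Q_n by [topD]; the difference is again in <P>
    and has lower degree. *)
Lemma ideal_eq_of_top :
  (forall n x, ideal P x -> tdeg_le n x -> ideal R (hpart n x)) ->
  P `<=` ideal (alpha @` R) /\ forall n, jacobi (alpha @` R) n.
Proof.
move=> PR.
have sD n : subspace (syz_le R alpha n) by exact: span_subspace.
have sJ := (ideal_two_sided (alpha @` R)).1.
have DQ n : syz_le R alpha n `<=` ideal (alpha @` R).
  apply: (span_sub sJ) => _ [u [s [r [w [Rr _ _ ->]]]]].
  apply: (ideal_two_sided _).2; apply: sub_gen_smallest; by exists r.
have QP : ideal (alpha @` R) `<=` ideal P.
  apply: smallest_sub; first exact: ideal_two_sided.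
  by move=> x /alphaP; exact: sub_gen_smallest.
have topD n x : ideal R x -> exists y, [/\ syz_le R alpha n y, tdeg_le n y &
    hpart n y = hpart n x].
  move: x; apply: (@ideal_ind _ _ R Rhom Rlow [set x |
    exists y, [/\ syz_le R alpha n y, tdeg_le n y & hpart n y = hpart n x]]).
    split=> [|a x x' [y [Py yn yx]] [y' [Py' yn' yx']]].
      exists 0; split; [exact: (sub0 (sD n))|exact: (sub0 (tdeg_le_subspace n))|].
      exact: erefl.
    exists (a *: y + y'); split; first exact: (sD n).2.
      exact: (tdeg_le_subspace n).2.
    by rewrite !hpart_is_linear yx yx'.
  move=> u s r w Rr rs; rewrite /=.
  have Gz := @syz_gen _ _ R alpha (fun _ _ => true) _ u s.+1 r w Rr rs (erefl _) isT.
  have [/= xd yd yE] := syz_top sR Rlow alphaL alpha_top Gz.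
  have [mn|/negPf mn] := eqVneq (size u + s.+1 + size w)%N n; last first.
    exists 0; rewrite (hpart_tdeg n xd) mn hpart0.
    by split; [exact: (sub0 (sD n))|exact: (sub0 (tdeg_le_subspace n))|].
  rewrite mn in xd yd yE; exists (mon u * alpha r * mon w).
  split; [|exact: yd|exact: (etrans yE (esym (hpart_ident xd)))].
  by apply: (syz_le_gen (alpha := alpha) Rr rs); rewrite mn.
have PD n x : ideal P x -> tdeg_le n x -> syz_le R alpha n x.
  elim: n x => [|n IH] x Px xn.
    have [y [Dy yn yE]] := topD 0 _ (PR _ _ Px xn).
    have -> : x = y.
      rewrite -(hpart0_le xn) -(hpart0_le yn) yE.
      by rewrite (hpart_ident (@tdeg_hpart _ _ 0 x)).
    exact: Dy.
  have [y [Dy yn yE]] := topD n.+1 _ (PR _ _ Px xn).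
  rewrite -[x](subrK y); apply: (subD (sD _)) (Dy).
  apply: syz_leW (leqnSn n) (IH _ _ _).
    by apply: (subB (ideal_two_sided P).1 Px); exact: QP _ (DQ _ _ Dy).
  apply: tdeg_le_lt; first exact: (subB (tdeg_le_subspace _) xn yn).
  by rewrite hpartB yE (hpart_ident (@tdeg_hpart _ _ n.+1 x)) subrr.
split=> [x Px|n x [+ xn]].
  have [n xn] := exists_tdeg_le x; apply: (DQ n); apply: PD xn.
  exact: sub_gen_smallest.
rewrite !(jacobi_spaceE sR Rhom alphaL alpha_top) => Dx.
by apply: PD xn; exact: QP _ (DQ _ _ Dx).
Qed.

End TopDegreeParts.

Theorem theorem5p25 (K : fieldType) (V : vectType K)
    (I R : set (tensor_alg V)) (S : {fset nat}) (P : set (tensor_alg V)) :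
  space_of_relations I R S ->
  multi_koszul I R S ->
  subspace P ->
  R `<=` top_parts P ->
  (pbw_deformation R P <->
   ideal R = ideal (top_parts P) /\
   exists alpha : tensor_alg V -> tensor_alg V,
     [/\ filtered_morphism R alpha,
         alpha @` R `<=` P,
         P `<=` ideal (alpha @` R) &
         c_inv (alg_deg I) = (-1)%:E \/
         forall n, (1 <= n <= \max_(s <- S) s)%N -> jacobi (alpha @` R) n]).
Proof.
move=> rel mk sP RP.
have sR := rel_subspace rel; have Rhom := relations_hpart rel.
have Rlow := relations_low rel.
have IE := relations_generate rel.
split=> [pbw|[_ [alpha [[alphaL alpha_deg] alphaP PQ jac]]]].
  have PR := pbw_top pbw.
  split.
    apply/seteqP; split; apply: smallest_sub; try exact: ideal_two_sided.
      by move=> x /RP; exact: sub_gen_smallest.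
    apply: (span_sub (ideal_two_sided R).1) => _ [n _ [y [Py yn] <-]].
    by rewrite tprojE; apply: PR yn; exact: sub_gen_smallest.
  have [alpha [[alphaL alpha_deg] alphaP]] :=
    exists_filtered_morphism sR Rhom (rel_finite_dimensional rel) sP RP.
  have alpha_top n r : R r -> tdeg n r ->
      tdeg_le n (alpha r) /\ hpart n (alpha r) = r.
    by rewrite -tprojE; exact: alpha_deg.
  have [PQ jac] := ideal_eq_of_top sR Rhom Rlow alphaL alpha_top alphaP PR.
  (* For a PBW-deformation all Jacobi conditions hold, whatever c(A) is. *)
  by exists alpha; split=> //; right=> n _.
have alpha_top n r : R r -> tdeg n r ->
    tdeg_le n (alpha r) /\ hpart n (alpha r) = r.
  by rewrite -tprojE; exact: alpha_deg.
have trivial n : syz_trivial R alpha n.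
  elim: n => [|n IH]; first exact: (syz_trivial0 sR Rlow alphaL).
  have step : Tor (alg_deg I) 3 n.+2 = [set 0] -> syz_trivial R alpha n.+1.
    move=> T0; apply: (syz_trivial_step sR Rhom Rlow alphaL alpha_top
      (rel_ideal rel) (ideal_low rel) IE (relations_indecomposable rel) T0 IH).
  case: jac => [c0|jac]; first by apply: step; exact: c_inv_Tor3.
  (* Up to N = max S the Jacobi conditions apply; beyond it n + 2 differs from s + 1 for every [s]
     in [S], so Tor_(3,n+2) is zero. *)
  have [nN|Nn] := leqP n.+1 (\max_(s <- S) s).
    exact: (jacobi_syz_trivial sR Rhom Rlow alphaL alpha_top (jac n.+1 nN)).
  apply: step; apply: (multi_koszul_Tor3 mk) => s sS.
  have : (s <= \max_(s <- S) s)%N by apply: (@leq_bigmax_seq _ _ xpredT id).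
  by move=> sN; rewrite eqSS neq_ltn (leq_ltn_trans sN Nn).
have PQ' : ideal P `<=` ideal (alpha @` R).
  by apply: smallest_sub => //; exact: ideal_two_sided.
apply: pbw_of_top => n x; last exact: (ideal_lift sR Rhom Rlow alphaL alpha_top alphaP).
by move=> /PQ'; exact: (ideal_top sR Rhom Rlow alphaL alpha_top trivial).
Qed.
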